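(* Let $U$ be an optimal machine. For probabilistic algorithms $A$ (deciding $\mathrm{dom}(U)$ approximately) we still have: (a) $\underline{E}(A)>0$ for every $A$; (b) there exists $\varepsilon>0$ such that $\overline{E}(A)\ge \varepsilon$ for every $A$.
   Context: A machine is a partial computable function from binary strings to binary strings; for a machine $V$ let $C_V(x)=\min\{|p|\colon V(p)=x\}$ (plain Kolmogorov complexity with respect to $V$). $U$ is optimal if for every machine $V$ there is $c$ with $C_U(x)\le C_V(x)+c$ for all $x$. A randomized algorithm $A$ uses fair coin tosses; on input $x$ it errs if $x\in\mathrm{dom}(U)$ and it does not output $1$, or $x\notin\mathrm{dom}(U)$ and it does not output $0$ (no answer counts as an error). $\varepsilon_n(A)$ is the probability of error on a random input uniformly distributed among all strings of length at most $n$ (the random bits of $A$ independent of the input choice); $\overline{E}(A)=\limsup_n\varepsilon_n(A)$, $\underline{E}(A)=\liminf_n\varepsilon_n(A)$. *)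

(* Defs.v *)
From HB Require Import structures.
From Stdlib Require List.
Import List.ListNotations.
From mathcomp Require Import all_boot all_order all_algebra.
From mathcomp Require Import all_classical all_reals all_analysis.
From Stdlib Require Import Reals.
From mathcomp Require Import Rstruct.
Import Order.TTheory GRing.Theory Num.Theory.

Set Implicit Arguments.
Unset Strict Implicit.
Unset Printing Implicit Defensive.

Local Open Scope classical_set_scope.
Local Open Scope ring_scope.

(* A model of computation: mu-recursive functions on nat (untyped     *)
(* arity: arguments are a list, out-of-range projections give 0),     *)
(* with big-step relational semantics.                                *)
Inductive mu_rec : Type :=
| MZero
| MSucc
| MProj (i : nat)
| MComp (f : mu_rec) (gs : list mu_rec)
| MRec (f g : mu_rec)
| MMu (f : mu_rec).

Inductive eval : mu_rec -> list nat -> nat -> Prop :=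
| eZero args : eval MZero args 0
| eSucc args : eval MSucc args (S (List.nth 0 args 0))
| eProj i args : eval (MProj i) args (List.nth i args 0)
| eComp f gs args ys z :
    List.Forall2 (fun g y => eval g args y) gs ys ->
    eval f ys z -> eval (MComp f gs) args z
| eRec0 f g args y : eval f args y -> eval (MRec f g) (0 :: args) y
| eRecS f g n args z y :
    eval (MRec f g) (n :: args) z -> eval g (n :: z :: args) y ->
    eval (MRec f g) (S n :: args) y
| eMu f args n :
    eval f (n :: args) 0 ->
    (forall m, (m < n)%coq_nat -> exists k, eval f (m :: args) (S k)) ->
    eval (MMu f) args n.

(* Bijective coding of binary strings by naturals:
   code [::] = 0, code (s ++ [:: b]) = 2 * code s + 1 + b. *)
Definition code (s : seq bool) : nat :=
  foldl (fun n (b : bool) => (n.*2 + b).+1) 0 s.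

Definition machine (V : seq bool -> option (seq bool)) : Prop :=
  exists p : mu_rec, forall (x : seq bool) (v : nat),
    eval p (code x :: nil) v <-> exists y, V x = Some y /\ v = code y.

(* Optimality: C_U(x) <= C_V(x) + c for all x, written out
   (C_V(x) = min{|p| : V p = x}, infinite if there is no such p). *)
Definition optimal (U : seq bool -> option (seq bool)) : Prop :=
  forall V, machine V -> exists c : nat, forall x p : seq bool,
    V p = Some x -> exists q, U q = Some x /\ (size q <= size p + c)%nat.

Definition in_dom (U : seq bool -> option (seq bool)) (x : seq bool) : Prop :=
  exists y, U x = Some y.

(* Randomized algorithms (probabilistic machines with fair coins).    *)
(* A x r describes the behaviour of the algorithm on input x after    *)
(* having read the coin bits r:                                       *)
(*   None            : it runs forever without asking for a new bit,  *)
(*   Some None       : it asks for the next coin bit,                 *)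
(*   Some (Some y)   : it halts with output y.                        *)
Definition rand_alg
  (A : seq bool -> seq bool -> option (option (seq bool))) : Prop :=
  exists p : mu_rec, forall (x r : seq bool) (v : nat),
    eval p (code x :: code r :: nil) v <->
    (A x r = Some None /\ v = 0%nat) \/
    (exists y, A x r = Some (Some y) /\ v = (code y).+1).

(* The run on input x reads exactly the coin bits r and then halts with y. *)
Definition halts_with (A : seq bool -> seq bool -> option (option (seq bool)))
  (x r y : seq bool) : Prop :=
  A x r = Some (Some y) /\
  (forall k, (k < size r)%nat -> A x (take k r) = Some None).

Definition prob (A : seq bool -> seq bool -> option (option (seq bool)))
  (x y : seq bool) : R :=
  fine (\esum_(r in [set r | halts_with A x r y]) (((2 : R)^-1) ^+ size r)%:E).

Definition answer (U : seq bool -> option (seq bool)) (x : seq bool) : seq bool :=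
  if `[< in_dom U x >] then [:: true] else [:: false].

(* Probability that A errs on x (no answer counts as an error). *)
Definition err_prob (U : seq bool -> option (seq bool))
  (A : seq bool -> seq bool -> option (option (seq bool))) (x : seq bool) : R :=
  1 - prob A x (answer U x).

Fixpoint strings_of_len (k : nat) : seq (seq bool) :=
  match k with
  | 0 => [:: [::]]
  | k'.+1 => [seq b :: s | b <- [:: false; true], s <- strings_of_len k']
  end.

Definition strings_upto (n : nat) : seq (seq bool) :=
  flatten [seq strings_of_len k | k <- iota 0 n.+1].

Definition eps (U : seq bool -> option (seq bool))
  (A : seq bool -> seq bool -> option (option (seq bool))) (n : nat) : R :=
  (\sum_(x <- strings_upto n) err_prob U A x) / (size (strings_upto n))%:R.

Definition E_sup U A : \bar R := limn_esup (fun n => (eps U A n)%:E).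
Definition E_inf U A : \bar R := limn_einf (fun n => (eps U A n)%:E).

(* Main.v *)
Require Import Defs.
From HB Require Import structures.
From mathcomp Require Import all_boot all_order all_algebra.
From mathcomp Require Import all_classical all_reals all_analysis.
From Stdlib Require Import Reals.
From mathcomp Require Import Rstruct.
From mathcomp Require Import zify ring lra.
Import Order.TTheory GRing.Theory Num.Theory.

(* A program that knows the number H of halting programs of length at most n can
   wait until all of them have stopped and then print an object of complexity
   greater than n.  Knowing H up to an error of order 2^(n-2d), one can give the
   remaining bits of H in a program of length n - d + O(1), from which n and d
   can be read off as well; so for d large no computable approximation of
   that precision exists, for any n.

   If the total error of A over the inputs of length at most n is below
   2^(n-2d) / 2, such an approximation comes from A: wait until the answers 0 and
   1 have together almost all of the probability mass and take the expected
   number of answers 1.  This gives (a).  In (b) the constant d must not depend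
   on A.  The approximations for 2^K <= n < 2^(K+1) form a table that is
   computable from K, hence it is the output of some U-program q with
   |q| <= log K + O(1) < K.  As code q < 2^K, there is an n in this range that
   encodes q, and for this n the approximation can be found by means of U only,
   without any reference to A. *)

Set Implicit Arguments.
Unset Strict Implicit.
Unset Printing Implicit Defensive.

(* The names [eval], [code] and the notation [^] are shadowed by the libraries. *)
Local Notation eval := Defs.eval.
Local Notation code := Defs.code.
Local Notation "m ^ n" := (expn m n) : nat_scope.

(** * Total computable functions *)

(** The induction principle generated for [mu_rec] has no hypothesis for the members of the list
    [gs] in [MComp]. *)
Lemma mu_rec_nested_ind (P : mu_rec -> Prop) :
  P MZero -> P MSucc -> (forall i, P (MProj i)) ->
  (forall f gs, P f -> List.Forall P gs -> P (MComp f gs)) ->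
  (forall f g, P f -> P g -> P (MRec f g)) ->
  (forall f, P f -> P (MMu f)) -> forall p, P p.
Proof.
move=> P0 PS PP PC PR PM; fix IH 1; case=> [||i|f gs|f g|f].
- exact: P0.
- exact: PS.
- exact: PP.
- by apply: PC => //; elim: gs => [|g gs IHgs]; constructor.
- exact: PR.
- exact: PM.
Qed.

Lemma List_nth_nth i (l : seq nat) : List.nth i l 0 = nth 0 l i.
Proof. by elim: l i => [|x l IH] [|i] //=. Qed.

(** Uniqueness of the value is not demanded here; it follows later from the fuel functions, by
    [stable_eq]. *)
Definition computable (k : nat) (f : seq nat -> nat) : Prop :=
  exists p, forall l, size l = k -> eval p l (f l).

Definition computableb (k : nat) (f : seq nat -> bool) : Prop := computable k (fun l => f l).

(** Argument vectors for [MComp]. The equation is asked only on lists of length [k], so that [E] may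
    be an operation such as [drop j]. *)
Definition computable_seq (k r : nat) (E : seq nat -> seq nat) : Prop :=
  exists gs : seq (seq nat -> nat), [/\ size gs = r, List.Forall (computable k) gs &
    forall l, size l = k -> E l = [seq g l | g <- gs]].

Lemma computable_ext k f g : (forall l, size l = k -> f l = g l) -> computable k f -> computable k
  g.
Proof. by move=> fg [p hp]; exists p => l hl; rewrite -fg //; exact: hp. Qed.

Lemma computable_nth k i : computable k (fun l => nth 0 l i).
Proof. by exists (MProj i) => l _; rewrite -List_nth_nth; constructor. Qed.

Lemma computable_var k i f : (forall l, f l = nth 0 l i) -> computable k f.
Proof. by move=> fE; apply: computable_ext (computable_nth k i). Qed.

Lemma computable_seq_nil k : computable_seq k 0 (fun=> [::]).
Proof. by exists [::]; split. Qed.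

Lemma computable_seq_cons k r g E : computable k g -> computable_seq k r E -> computable_seq k r.+1
  (fun l => g l :: E l).
Proof.
move=> hg [gs [<- h1 h2]]; exists (g :: gs); split => //; first by constructor.
by move=> l hl /=; rewrite h2.
Qed.

Lemma computable_seq_drop k j : computable_seq (j + k) k (drop j).
Proof.
exists [seq (fun l => nth 0 l (j + i)) | i <- iota 0 k]; split.
- by rewrite size_map size_iota.
- by move: (j + k) => K; elim: k {2}0 => [|k IH] m; [exact: List.Forall_nil|apply:
  List.Forall_cons; [exact: computable_nth|exact: IH]].
- move=> l hl; apply: (@eq_from_nth _ 0); first by rewrite size_drop !size_map size_iota; lia.
  move=> i; rewrite size_drop hl => hi; rewrite nth_drop -map_comp (nth_map 0) /= ?size_iota; last
    by lia.
  by rewrite nth_iota; last lia.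
Qed.

Lemma computable_seq_app k r f E : computable r f -> computable_seq k r E -> computable k (fun l =>
  f (E l)).
Proof.
move=> [p hp] [gs [hr h1 h2]].
have [ps hps] : exists ps, forall l, size l = k ->
    List.Forall2 (fun g y => eval g l y) ps [seq g l | g <- gs].
  elim: gs h1 {h2 hr} => [|g gs IH] h1; first by exists [::] => l _; constructor.
  have [[q hq] /IH[qs hqs]] : computable k g /\ List.Forall (computable k) gs by inversion h1.
  by exists (q :: qs) => l hl /=; constructor; [exact: hq|exact: hqs].
exists (MComp p ps) => l hl; apply: eComp (hps l hl) _.
by rewrite h2 //; apply: hp; rewrite size_map.
Qed.

Lemma computable_const k c : computable k (fun=> c).
Proof.
elim: c => [|c [p hp]]; first by exists MZero => l _; constructor.
exists (MComp MSucc [:: p]) => l hl; apply: (eComp (ys := [:: c])).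
  by constructor; [exact: hp|constructor].
exact: (eSucc [:: c]).
Qed.

Lemma computable_succ k f : computable k f -> computable k (fun l => (f l).+1).
Proof.
move=> [p hp]; exists (MComp MSucc [:: p]) => l hl; apply: (eComp (ys := [:: f l])).
  by constructor; [exact: hp|constructor].
exact: (eSucc [:: f l]).
Qed.

Lemma computable_rec k (a N : seq nat -> nat) (step : nat -> nat -> seq nat -> nat) :
  computable k a -> computable k.+2 (fun l => step (nth 0 l 0) (nth 0 l 1) (drop 2 l)) ->
    computable k N ->
  computable k (fun l => nat_rect (fun=> nat) (a l) (fun i z => step i z l) (N l)).
Proof.
move=> [pa ha] [ps hs] hN.
(* [MRec] recurses on the head of its argument list; composition then puts [N l] in that place. *)
have h : computable k.+1 (fun l => nat_rect (fun=> nat) (a (drop 1 l))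
    (fun i z => step i z (drop 1 l)) (nth 0 l 0)).
  exists (MRec pa ps) => [[//|n l]] [hl] /=; rewrite drop0.
  elim: n => [|n IH] /=; first by constructor; apply: ha.
  apply: eRecS IH _.
  by have /= := hs [:: n, (nat_rect (fun=> nat) (a l) (fun i z => step i z l) n) & l];
    rewrite drop0 hl; apply.
have := computable_seq_app h (computable_seq_cons hN (computable_seq_drop k 0)).
by apply: computable_ext => l _ /=; rewrite !drop0.
Qed.

Lemma computable_comp1 k (f : nat -> nat) g :
  computable 1 (fun l => f (nth 0 l 0)) -> computable k g -> computable k (fun l => f (g l)).
Proof. move=> hf hg; exact: (computable_seq_app hf (computable_seq_cons hg (computable_seq_nil
  k))). Qed.

Lemma computable_comp2 k (f : nat -> nat -> nat) g h :
  computable 2 (fun l => f (nth 0 l 0) (nth 0 l 1)) -> computable k g -> computable k h ->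
  computable k (fun l => f (g l) (h l)).
Proof. move=> hf hg hh; exact: (computable_seq_app hf (computable_seq_cons hg (computable_seq_cons
  hh (computable_seq_nil k)))). Qed.

Lemma computable_comp3 k (f : nat -> nat -> nat -> nat) g h i :
  computable 3 (fun l => f (nth 0 l 0) (nth 0 l 1) (nth 0 l 2)) -> computable k g -> computable k h
    -> computable k i ->
  computable k (fun l => f (g l) (h l) (i l)).
Proof.
by move=> hf hg hh hi;
  exact: (computable_seq_app hf (computable_seq_cons hg (computable_seq_cons hh
    (computable_seq_cons hi (computable_seq_nil k))))).
Qed.

Ltac computable_proj := eapply computable_var; intros; rewrite ?nth_drop ?nth_behead; reflexivity.

Lemma computable_add k f g : computable k f -> computable k g -> computable k (fun l => f l + g l).
Proof.
apply: (@computable_comp2 k addn).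
apply: (@computable_ext _ (fun l => nat_rect (fun=> nat) (nth 0 l 0) (fun i z => z.+1) (nth 0 l
  1))).
  by move=> l _; elim: (nth 0 l 1) => [|n IH] /=; rewrite ?addn0 // IH addnS.
apply: (@computable_rec 2 _ _ (fun i z l => z.+1)); [exact: computable_nth| |exact: computable_nth].
exact/computable_succ/computable_nth.
Qed.

Lemma computable_pred k f : computable k f -> computable k (fun l => (f l).-1).
Proof.
apply: (@computable_comp1 k predn).
apply: (@computable_ext _ (fun l => nat_rect (fun=> nat) 0 (fun i z => i) (nth 0 l 0))).
  by move=> l _; case: (nth 0 l 0).
apply: (@computable_rec 1 _ _ (fun i z l => i)); [exact: computable_const|exact:
  computable_nth|exact: computable_nth].
Qed.

Lemma computable_sub k f g : computable k f -> computable k g -> computable k (fun l => f l - g l).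
Proof.
apply: (@computable_comp2 k subn).
apply: (@computable_ext _ (fun l => nat_rect (fun=> nat) (nth 0 l 0) (fun i z => z.-1) (nth 0 l
  1))).
  by move=> l _; elim: (nth 0 l 1) => [|n IH] /=; rewrite ?subn0 // IH subnS.
apply: (@computable_rec 2 _ _ (fun i z l => z.-1)); [exact: computable_nth| |exact: computable_nth].
exact/computable_pred/computable_nth.
Qed.

Lemma computable_sum k (N : seq nat -> nat) (F : nat -> seq nat -> nat) :
  computable k N -> computable k.+1 (fun l => F (nth 0 l 0) (behead l)) ->
  computable k (fun l => \sum_(0 <= i < N l) F i l).
Proof.
move=> hN hF.
apply: (@computable_ext _ (fun l => nat_rect (fun=> nat) 0 (fun i z => z + F i l) (N l))).
  move=> l _; elim: (N l) => [|n IH]; first by rewrite big_geq.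
  by rewrite big_nat_recr //= IH.
apply: (@computable_rec k _ _ (fun i z l => z + F i l)) => //; first exact: computable_const.
apply: computable_add; first exact: computable_nth.
have := computable_seq_app hF (computable_seq_cons (computable_nth k.+2 0) (computable_seq_drop k
  2)).
by apply: computable_ext => l _.
Qed.

Lemma computable_mul k f g : computable k f -> computable k g -> computable k (fun l => f l * g l).
Proof.
apply: (@computable_comp2 k muln).
apply: (@computable_ext _ (fun l => \sum_(0 <= i < nth 0 l 0) nth 0 l 1)).
  by move=> l _; rewrite sum_nat_const_nat subn0.
apply: (@computable_sum 2 _ (fun i l => nth 0 l 1)); first exact: computable_nth.
by computable_proj.
Qed.

Lemma computable_exp k f g : computable k f -> computable k g -> computable k (fun l => f l ^ g l).
Proof.
apply: (@computable_comp2 k expn).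
apply: (@computable_ext _ (fun l => nat_rect (fun=> nat) 1 (fun i z => z * nth 0 l 0) (nth 0 l 1))).
  by move=> l _; elim: (nth 0 l 1) => [|n IH] //=; rewrite IH expnSr.
apply: (@computable_rec 2 _ _ (fun i z l => z * nth 0 l 0)); [exact: computable_const| |exact:
  computable_nth].
by apply: computable_mul; computable_proj.
Qed.

Lemma computable_if k (b : seq nat -> bool) f g :
  computableb k b -> computable k f -> computable k g -> computable k (fun l => if b l then f l
    else g l).
Proof.
move=> hb hf hg; apply: (@computable_ext _ (fun l => b l * f l + (1 - b l) * g l)).
  by move=> l _; case: (b l) => /=; rewrite ?mul1n ?mul0n ?addn0.
by repeat first [apply: computable_add|apply: computable_mul|apply: computable_sub|apply:
  computable_const|done].
Qed.

Lemma computableb_eq0 k f : computable k f -> computableb k (fun l => f l == 0).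
Proof.
move=> hf; apply: (@computable_ext _ (fun l => 1 - f l)); first by move=> l _; case: (f l).
by apply: computable_sub => //; apply: computable_const.
Qed.

Lemma computableb_leq k f g : computable k f -> computable k g -> computableb k (fun l => f l <= g
  l).
Proof. move=> hf hg; exact/computableb_eq0/computable_sub. Qed.

Lemma computableb_neg k b : computableb k b -> computableb k (fun l => ~~ b l).
Proof.
move=> hb; apply: (@computable_ext _ (fun l => b l == 0 :> nat)); first by move=> l _; case: (b l).
exact: computableb_eq0.
Qed.

Lemma computableb_and k b c : computableb k b -> computableb k c -> computableb k (fun l => b l &&
  c l).
Proof.
move=> hb hc; apply: (@computable_ext _ (fun l => b l * c l)).
  by move=> l _; case: (b l); case: (c l).
exact: computable_mul.
Qed.

Lemma computableb_eq k f g : computable k f -> computable k g -> computableb k (fun l => f l == g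
  l).
Proof.
move=> hf hg; apply: (@computable_ext _ (fun l => (f l <= g l) && (g l <= f l))).
  by move=> l _; rewrite eqn_leq.
by apply: computableb_and; apply: computableb_leq.
Qed.

(** A bounded universal quantifier holds iff the number of counterexamples, a bounded sum, is
    zero. *)
Lemma computableb_all k (N : seq nat -> nat) (F : nat -> seq nat -> bool) :
  computable k N -> computableb k.+1 (fun l => F (nth 0 l 0) (behead l)) ->
  computableb k (fun l => all (fun i => F i l) (iota 0 (N l))).
Proof.
move=> hN hF.
apply: (@computable_ext _ (fun l => (\sum_(0 <= i < N l) (~~ F i l : nat)) == 0)).
  move=> l _; congr nat_of_bool; rewrite big_mkord sum_nat_eq0; apply/forallP/allP => /= h.
    by move=> i; rewrite mem_iota /= => hi; have := h (Ordinal hi) => /=; rewrite eqb0 negbK.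
  by move=> i; rewrite eqb0 negbK h // mem_iota /=.
apply: computableb_eq0; apply: (@computable_sum _ _ (fun i l => ~~ F i l)) => //; exact:
  computableb_neg.
Qed.

(* The least [i <= n] satisfying [P], and [n] if there is none. *)
Definition bmin (P : nat -> bool) (n : nat) : nat :=
  nat_rect (fun=> nat) 0 (fun i z => if P z then z else i.+1) n.

Lemma bmin_leq P n : bmin P n <= n.
Proof. by elim: n => //= n IH; case: ifP => // _; rewrite ltnW. Qed.

Lemma bmin_none (P : nat -> bool) n : ~~ P (bmin P n) -> bmin P n = n.
Proof. by case: n => //= n; case: ifP => // ->. Qed.

Lemma bmin_before (P : nat -> bool) n i : i < bmin P n -> ~~ P i.
Proof.
elim: n i => //= n IH i; case: ifP => [_|/negbT hP hi]; first exact: IH.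
have [/IH//|hni] := ltnP i (bmin P n).
suff -> : i = bmin P n by [].
by move: hni; rewrite (bmin_none hP) => ?; lia.
Qed.

Lemma bmin_true (P : nat -> bool) n i : i <= n -> P i -> P (bmin P n).
Proof.
move=> hi Pi; have [hl|hl] := ltnP i (bmin P n).
  by have := bmin_before hl; rewrite Pi.
elim: n hi hl => [|n IH] hi /=; first by move: hi Pi; rewrite leqn0 => /eqP->.
case: ifP => // hP hni; suff -> : n.+1 = i by [].
by lia.
Qed.

Lemma bmin_eq (P : nat -> bool) n i : i <= n -> P i -> (forall j, j < i -> ~~ P j) -> bmin P n = i.
Proof.
move=> hi Pi hj; have hP := bmin_true hi Pi; apply/eqP; rewrite eqn_leq; apply/andP; split.
  by rewrite leqNgt; apply/negP => /bmin_before; rewrite Pi.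
by rewrite leqNgt; apply/negP => /hj; rewrite hP.
Qed.

Lemma computable_bmin k (N : seq nat -> nat) (F : nat -> seq nat -> bool) :
  computable k N -> computableb k.+1 (fun l => F (nth 0 l 0) (behead l)) ->
  computable k (fun l => bmin (fun i => F i l) (N l)).
Proof.
move=> hN hF.
apply: (@computable_rec k _ _ (fun i z l => if F z l then z else i.+1)) => //; first exact:
  computable_const.
apply: computable_if; [|exact: computable_nth|exact/computable_succ/computable_nth].
have := computable_seq_app hF (computable_seq_cons (computable_nth k.+2 1) (computable_seq_drop k
  2)).
by apply: computable_ext => l _.
Qed.

Lemma computable_div k f g : computable k f -> computable k g -> computable k (fun l => f l %/ g l).
Proof.
apply: (@computable_comp2 k divn).
(* For divisor 0 the search would fail and return its bound, whereas [divn] gives 0. *)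
apply: (@computable_ext _ (fun l => if nth 0 l 1 == 0 then 0 else
    bmin (fun i => nth 0 l 0 < i.+1 * nth 0 l 1) (nth 0 l 0))).
  move=> l _; case: eqP => [->|/eqP]; first by rewrite divn0.
  rewrite -lt0n => h; apply: bmin_eq; first exact: leq_div.
    by rewrite -ltn_divLR.
  by move=> j hj; rewrite -leqNgt -leq_divRL.
apply: computable_if; [exact/computableb_eq0/computable_nth|exact: computable_const|].
apply: (@computable_bmin 2 _ (fun i l => nth 0 l 0 < i.+1 * nth 0 l 1)); first exact:
  computable_nth.
by apply: computableb_leq; [apply: computable_succ; computable_proj|apply: computable_mul; [apply:
  computable_succ|]; computable_proj].
Qed.

Lemma computable_mod k f g : computable k f -> computable k g -> computable k (fun l => f l %% g l).
Proof.
move=> hf hg; apply: (@computable_ext _ (fun l => f l - f l %/ g l * g l)).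
  by move=> l _; rewrite {1}(divn_eq (f l) (g l)) addKn.
by apply: computable_sub => //; apply: computable_mul => //; apply: computable_div.
Qed.

Lemma computable_lg k f : computable k f -> computable k (fun l => trunc_log 2 (f l)).
Proof.
apply: (@computable_comp1 k (trunc_log 2)).
apply: (@computable_ext _ (fun l => bmin (fun i => nth 0 l 0 < 2 ^ i.+1) (nth 0 l 0))).
  move=> l _; set n := nth 0 l 0.
  have [->//|n0] := posnP n.
  apply: bmin_eq; first by rewrite -ltnS -(@ltn_exp2l 2) //
      (leq_ltn_trans (trunc_logP _ n0)) // ltnW // ltn_expl.
    exact: trunc_log_ltn.
  by move=> j hj; rewrite -leqNgt (leq_trans _ (@trunc_logP 2 n isT n0)) ?leq_exp2l.
apply: (@computable_bmin 1 _ (fun i l => nth 0 l 0 < 2 ^ i.+1)); first exact: computable_nth.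
by apply: computableb_leq; [apply: computable_succ; computable_proj|apply: computable_exp; [apply:
  computable_const|apply: computable_succ; computable_proj]].
Qed.

(** The last three clauses handle functions whose computability is a hypothesis of the context, such
    as [TU], [TA] or [G]; [first by []] finds it there. *)
Ltac computable_step := lazymatch goal with
 | |- computable ?k (fun _ => ?c) => exact: computable_const
 | |- computable ?k (fun l => nth _ _ _) => computable_proj
 | |- computable ?k (fun l => nat_of_bool (@?b l)) => change (computableb k b)
 | |- computable ?k (fun l => S (@?f l)) => apply: (@computable_succ k f)
 | |- computable ?k (fun l => predn (@?f l)) => apply: (@computable_pred k f)
 | |- computable ?k (fun l => addn (@?f l) (@?g l)) => apply: (@computable_add k f g)
 | |- computable ?k (fun l => subn (@?f l) (@?g l)) => apply: (@computable_sub k f g)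
 | |- computable ?k (fun l => muln (@?f l) (@?g l)) => apply: (@computable_mul k f g)
 | |- computable ?k (fun l => expn (@?f l) (@?g l)) => apply: (@computable_exp k f g)
 | |- computable ?k (fun l => divn (@?f l) (@?g l)) => apply: (@computable_div k f g)
 | |- computable ?k (fun l => modn (@?f l) (@?g l)) => apply: (@computable_mod k f g)
 | |- computable ?k (fun l => trunc_log 2 (@?f l)) => apply: (@computable_lg k f)
 | |- computable ?k (fun l => if _ then _ else _) => apply: computable_if
 | |- computableb ?k (fun l => andb (@?b l) (@?c l)) => apply: (@computableb_and k b c)
 | |- computableb ?k (fun l => negb (@?b l)) => apply: (@computableb_neg k b)
 | |- computableb ?k (fun l => leq (@?f l) (@?g l)) => apply: (@computableb_leq k f g)
 | |- computableb ?k (fun l => eq_op (@?f l) (@?g l)) => apply: (@computableb_eq k f g)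
 | |- computableb ?k (fun l => all _ _) => apply: computableb_all
 | |- computable ?k (fun l => bigop _ _ _) => apply: computable_sum
 | |- computable ?k (fun l => bmin _ _) => apply: computable_bmin
 | |- computable ?k (fun l => ?f (@?g l) (@?h l) (@?i l)) => apply: (@computable_comp3 k f g h i);
   first by []
 | |- computable ?k (fun l => ?f (@?g l) (@?h l)) => apply: (@computable_comp2 k f g h); first by []
 | |- computable ?k (fun l => ?f (@?g l)) => apply: (@computable_comp1 k f g); first by []
 end.
Ltac computable_auto := repeat computable_step.

(** * Step-bounded evaluation and search *)
(** The value 0 means that there is no result yet; a result, once present, never changes. *)
Definition stable (h : nat -> nat) : Prop :=
  forall t t' v, h t = v.+1 -> t <= t' -> h t' = v.+1.

Lemma stable_eq h t t' v v' : stable h -> h t = v.+1 -> h t' = v'.+1 -> v = v'.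
Proof.
move=> hs h1 h2; have := hs _ _ _ h1 (leq_maxl t t').
by rewrite (hs _ _ _ h2 (leq_maxr t t')) => -[].
Qed.

(* [T (t :: a)] is [0] while the computation of [p] on [a] has not finished
   within fuel [t], and then the result plus one. *)
Definition fueled (p : mu_rec) (m : nat) (T : seq nat -> nat) : Prop :=
  [/\ computable m.+1 T, forall a, size a = m -> stable (fun t => T (t :: a)) &
      forall a v, size a = m -> (eval p a v <-> exists t, T (t :: a) = v.+1)].

Lemma fueled_total p m f : (forall l, size l = m -> eval p l (f l)) ->
  (forall l v, size l = m -> eval p l v -> v = f l) ->
  fueled p m (fun l => (f (behead l)).+1).
Proof.
move=> hp hv; split.
- have hf : computable m f by exists p.
  by apply: computable_succ; apply: computable_ext (computable_seq_app hf (computable_seq_drop m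
    1)) => l _; rewrite drop1.
- by move=> a ha t t' v.
- move=> a v ha; split=> [/(hv _ _ ha)->|[_ /= [<-]]]; [by exists 0|exact: hp].
Qed.

Lemma computableb_allseq k (Ts : seq (seq nat -> nat)) : List.Forall (computable k) Ts ->
  computableb k (fun l => all (fun T : seq nat -> nat => T l != 0) Ts).
Proof.
elim: Ts => [|T Ts IH] h; first exact: computable_const.
have [hT hTs] : computable k T /\ List.Forall (computable k) Ts by inversion h.
by apply: computableb_and; [exact/computableb_neg/computableb_eq0|exact: IH].
Qed.

Lemma computable_seq_map_pred k (Ts : seq (seq nat -> nat)) : List.Forall (computable k) Ts ->
  computable_seq k (size Ts) (fun l => [seq (T l).-1 | T : seq nat -> nat <- Ts]).
Proof.
elim: Ts => [|T Ts IH] h; first exact: computable_seq_nil.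
have [hT hTs] : computable k T /\ List.Forall (computable k) Ts by inversion h.
by apply: computable_seq_cons; [exact: computable_pred|exact: IH].
Qed.

(** Induction on [p], all subcomputations receiving the same fuel. By stability, the fuels that
    suffice for several subcomputations can be replaced by their maximum. *)
Lemma fueled_exists p m : exists T, fueled p m T.
Proof.
elim/mu_rec_nested_ind: p m => [||i|f gs IHf IHgs|f g IHf IHg|f IHf] m.
- exists (fun=> 1); apply: (fueled_total (f := fun=> 0)) => [l _|l v _ h]; first by constructor.
  by inversion h.
- exists (fun l => (nth 0 (behead l) 0).+2).
  apply: (fueled_total (f := fun l => (nth 0 l 0).+1)) => [l _|l v _ h].
    by rewrite -List_nth_nth; constructor.
  by inversion h; rewrite -List_nth_nth.
- exists (fun l => (nth 0 (behead l) i).+1).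
  apply: (fueled_total (f := fun l => nth 0 l i)) => [l _|l v _ h].
    by rewrite -List_nth_nth; constructor.
  by inversion h; rewrite -List_nth_nth.
- have [Ts hTs] : exists Ts, List.Forall2 (fun g T => fueled g m T) gs Ts.
    elim: gs IHgs => [|g gs IH] h; first by exists [::]; constructor.
    have [/(_ m)[T hT] /IH[Ts hTs]] : (forall m, exists T, fueled g m T) /\
       List.Forall (fun g => forall m, exists T, fueled g m T) gs by inversion h.
    by exists (T :: Ts); constructor.
  have hsz : size Ts = size gs by elim: hTs => //= g T gs' Ts' _ _ ->.
  have [Tf [hf1 hf2 hf3]] := IHf (size Ts).
  have hTs1 : List.Forall (computable m.+1) Ts.
    by elim: hTs => [|g T gs' Ts' [h _ _] _ IH]; [exact: List.Forall_nil|exact: List.Forall_cons].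
  pose done l := all (fun T : seq nat -> nat => T l != 0) Ts.
  pose res l := [seq (T l).-1 | T : seq nat -> nat <- Ts].
  have hres a t t' : size a = m -> done (t :: a) -> t <= t' ->
      done (t' :: a) /\ res (t' :: a) = res (t :: a).
    move=> ha + htt; rewrite /done /res.
    elim: hTs => //= g T gs' Ts' [_ hT _] _ IH /andP[hTa /IH[-> ->]].
    case E : (T (t :: a)) hTa => [//|v] _.
    by rewrite (hT _ ha _ _ _ E htt).
  have hev a ys : size a = m ->
      List.Forall2 (fun g y => eval g a y) gs ys <-> exists t, done (t :: a) /\ res (t :: a) = ys.
    move=> ha; rewrite /done /res.
    elim: hTs ys {hsz hf1 hf2 hf3 hTs1 done res hres IHgs} => [|g T gs' Ts' [_ hT2 hT3] hTs IH] ys.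
      split=> [h|[t [_ <-]]]; last by constructor.
      by inversion h; exists 0.
    have mono t t' : t <= t' -> all (fun T : seq nat -> nat => T (t :: a) != 0) Ts' ->
       all (fun T : seq nat -> nat => T (t' :: a) != 0) Ts' /\
       [seq (T (t' :: a)).-1 | T : seq nat -> nat <- Ts'] =
       [seq (T (t :: a)).-1 | T : seq nat -> nat <- Ts'].
      move=> htt; elim: hTs {IH} => //= g0 T0 gs0 Ts0 [_ hT _] _ IH /andP[hTa /IH[-> ->]].
      case E : (T0 (t :: a)) hTa => [//|v] _.
      by rewrite (hT _ ha _ _ _ E htt).
    split=> [h|[t [/= /andP[hTa hal] <-]]].
      have [y [ys' [-> hy hys]]] : exists y ys', [/\ ys = y :: ys', eval g a y &
          List.Forall2 (fun g y => eval g a y) gs' ys'].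
        by inversion h; subst; exists y, l'.
      have [t1 ht1] := (hT3 _ _ ha).1 hy.
      have [t2 [ht2 ht2']] := (IH _).1 hys.
      exists (maxn t1 t2) => /=.
      rewrite (hT2 _ ha _ _ _ ht1 (leq_maxl t1 t2)) /=.
      by have [-> ->] := mono _ _ (leq_maxr t1 t2) ht2; rewrite ht2'.
    constructor; last by apply/IH; exists t.
    apply/(hT3 _ _ ha); exists t; by case: (T _) hTa.
  exists (fun l => if done l then Tf (nth 0 l 0 :: res l) else 0); split.
  + apply: computable_if; [exact: computableb_allseq| |exact: computable_const].
    apply: (computable_seq_app hf1); apply: computable_seq_cons; [exact: computable_nth|exact:
      computable_seq_map_pred].
  + move=> a ha t t' v /=; case: ifP => // hd hTf htt.
    have [-> ->] := hres _ _ _ ha hd htt.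
    by apply: hf2 hTf htt; rewrite size_map.
  + move=> a v ha; split=> [h|[t /=]].
      have [ys hys hf] : exists2 ys, List.Forall2 (fun g y => eval g a y) gs ys & eval f ys v.
        by inversion h; exists ys.
      have [t1 [hd1 hr1]] := (hev _ _ ha).1 hys.
      have hsy : size ys = size Ts by rewrite -hr1 size_map.
      have [t2 ht2] := (hf3 _ _ hsy).1 hf.
      exists (maxn t1 t2) => /=.
      have [-> ->] := hres _ _ _ ha hd1 (leq_maxl t1 t2).
      by rewrite hr1; apply: hf2 ht2 (leq_maxr _ _).
    case: ifP => // hd hT; apply: (eComp (ys := res (t :: a))).
      by apply/(hev _ _ ha); exists t.
    by apply/hf3; [rewrite size_map|exists t].
- case: m => [|m].
    (* No rule evaluates [MRec] on the empty list. *)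
    exists (fun=> 0); split; [exact: computable_const|by []|].
    by move=> [|//] v _; split=> [h|[]//]; inversion h.
  have [Tf [hf1 hf2 hf3]] := IHf m; have [Tg [hg1 hg2 hg3]] := IHg m.+2.
  pose T t n a := nat_rect (fun=> nat) (Tf (t :: a))
    (fun i z => if z == 0 then 0 else Tg [:: t, i, z.-1 & a]) n.
  have hst a n : size a = m -> stable (fun t => T t n a).
    move=> ha; elim: n => [|n IH] t t' v /=; first exact: hf2.
    case: eqP => // /eqP; case E : (T t n a) => [//|z] _ hz htt.
    by rewrite (IH _ _ _ E htt) /=; apply: hg2 hz htt; rewrite /= ha.
  exists (fun l => T (nth 0 l 0) (nth 0 l 1) (drop 2 l)); split.
  + apply: (@computable_rec m.+2 (fun l => Tf (nth 0 l 0 :: drop 2 l)) (fun l => nth 0 l 1)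
      (fun i z l => if z == 0 then 0 else Tg [:: nth 0 l 0, i, z.-1 & drop 2 l])).
    * apply: (computable_seq_app hf1); apply: computable_seq_cons; [exact: computable_nth|exact:
      (computable_seq_drop m 2)].
    * apply: computable_if; [exact/computableb_eq0/computable_nth|exact: computable_const|].
      apply: (computable_seq_app hg1); apply: computable_seq_cons; first by computable_proj.
      apply: computable_seq_cons; first exact: computable_nth.
      apply: computable_seq_cons; first exact/computable_pred/computable_nth.
      have [gs [h1 h2 h3]] := computable_seq_drop m 4; exists gs; split => // l hl.
      by rewrite drop_drop; apply: h3.
    * exact: computable_nth.
  + by case=> [//|n a] [ha] t t' v /=; rewrite drop0; apply: hst.
  + case=> [//|n a] v [ha] /=; rewrite drop0; elim: n v => [|n IH] v.
      split=> [h|h]; first by apply/hf3 => //; inversion h.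
      by constructor; apply/hf3.
    split=> [h|[t /=]].
      have [z hz hg] : exists2 z, eval (MRec f g) (n :: a) z & eval g (n :: z :: a) v.
        by inversion h; exists z.
      have [t1 ht1] := (IH _).1 hz.
      have [|t2 ht2] := (hg3 _ _ _).1 hg; first by rewrite /= ha.
      exists (maxn t1 t2) => /=.
      rewrite (hst _ _ ha _ _ _ ht1 (leq_maxl _ _)) /=.
      by apply: hg2 ht2 (leq_maxr _ _); rewrite /= ha.
    case: eqP => // /eqP; case E : (T t n a) => [//|z] _ hz.
    apply: (eRecS (z := z)); first by apply/IH; exists t.
    by apply/hg3; [rewrite /= ha|exists t].
- have [Tf [hf1 hf2 hf3]] := IHf m.+1.
  (* The search stops at the first [i] where [f] is unfinished (0) or has returned zero (1). Only
     the second case counts as a result; then [f] is known to be positive at all smaller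
     arguments. *)
  pose P t a := bmin (fun i => Tf [:: t, i & a] <= 1) t.
  have hP t a v : (if Tf [:: t, P t a & a] == 1 then (P t a).+1 else 0) = v.+1 ->
      [/\ P t a = v, v <= t, Tf [:: t, v & a] = 1 & forall i, i < v -> 1 < Tf [:: t, i & a]].
    case: eqP => // h [<-]; split=> //; first exact: bmin_leq.
    by move=> i /bmin_before; rewrite -ltnNge.
  have hP' t a v : v <= t -> Tf [:: t, v & a] = 1 -> (forall i, i < v -> 1 < Tf [:: t, i & a]) ->
      (if Tf [:: t, P t a & a] == 1 then (P t a).+1 else 0) = v.+1.
    move=> hvt hv hi; have -> : P t a = v.
      by apply: bmin_eq => //; [rewrite hv|move=> j /hi; rewrite -ltnNge].
    by rewrite hv.
  exists (fun l => let s := P (nth 0 l 0) (behead l) in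
     if Tf [:: nth 0 l 0, s & behead l] == 1 then s.+1 else 0); split.
  + have hs : computable m.+1 (fun l => P (nth 0 l 0) (behead l)).
      apply: (@computable_bmin m.+1 (fun l => nth 0 l 0)
        (fun i l => Tf [:: nth 0 l 0, i & behead l] <= 1)); first exact: computable_nth.
      apply: computableb_leq; last exact: computable_const.
      apply: (computable_seq_app hf1); apply: computable_seq_cons; first by computable_proj.
      apply: computable_seq_cons; first exact: computable_nth.
      have [gs [h1 h2 h3]] := computable_seq_drop m 2; exists gs; split => // l hl.
      by rewrite -!drop1 drop_drop; apply: h3.
    apply: computable_if; [apply: computableb_eq; last exact: computable_const|exact:
      computable_succ|exact: computable_const].
    apply: (computable_seq_app hf1); apply: computable_seq_cons; first exact: computable_nth.
    apply: computable_seq_cons => //.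
    have [gs [h1 h2 h3]] := computable_seq_drop m 1; exists gs; split => // l hl.
    by rewrite -!drop1; apply: h3.
  + move=> a ha t t' v /= /hP[_ hvt hv hi] htt.
    have st i : stable (fun t => Tf [:: t, i & a]) by apply: hf2; rewrite /= ha.
    apply: hP'; first exact: leq_trans htt.
      exact: st hv htt.
    move=> i /hi; case E : (Tf [:: t, i & a]) => [//|[//|k]] _.
    by rewrite (st i _ _ _ E htt).
  + move=> a v ha.
    have st i : stable (fun t => Tf [:: t, i & a]) by apply: hf2; rewrite /= ha.
    have ev i w : eval f (i :: a) w <-> exists t, Tf [:: t, i & a] = w.+1.
      by apply: hf3; rewrite /= ha.
    split=> [h|[t /= /hP[_ _ hv hi]]]; last first.
      apply: eMu; first by apply/ev; exists t.
      move=> i /ssrnat.ltP /hi; case E : (Tf _) => [//|[//|k]] _; exists k; apply/ev; by exists t.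
    have [/ev[t0 ht0] hi] : eval f (v :: a) 0 /\
        (forall m, (m < v)%coq_nat -> exists k, eval f (m :: a) k.+1) by inversion h.
    have [t1 ht1] : exists t1, forall i, i < v -> 1 < Tf [:: t1, i & a].
      have {hi} : forall i, i < v -> exists k, eval f (i :: a) k.+1 by move=> i /ssrnat.ltP /hi.
      elim: (v) => [|w IH] hi; first by exists 0.
      have [i hiw|t1 ht1] := IH; first by apply: hi; exact: ltnW.
      have [k /ev[t2 ht2]] := hi w (ltnSn w).
      exists (maxn t1 t2) => i; rewrite ltnS leq_eqVlt => /orP[/eqP->|/ht1].
        by rewrite (st w _ _ _ ht2 (leq_maxr _ _)).
      case E : (Tf _) => [//|[//|j]] _.
      by rewrite (st i _ _ _ E (leq_maxl _ _)).
    (* The fuel bounds the search as well, hence it must be at least [v]. *)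
    exists (maxn v (maxn t0 t1)) => /=; apply: hP'; first exact: leq_maxl.
      by apply: st ht0 _; lia.
    move=> i /ht1; case E : (Tf _) => [//|[//|j]] _.
    by rewrite (st i _ _ _ E) //; lia.
Qed.

(** * Coding of strings, and machines that search *)

Lemma code_rcons s b : code (rcons s b) = ((code s).*2 + b).+1.
Proof. by rewrite /code -cats1 foldl_cat. Qed.

(** In binary, [(code s).+1] is the digit 1 followed by [s]. *)
Lemma code_bounds s : 2 ^ size s <= (code s).+1 < 2 ^ (size s).+1.
Proof.
elim/last_ind: s => // s b; rewrite code_rcons size_rcons !expnS.
by case: b; lia.
Qed.

Lemma trunc_log_code s : trunc_log 2 (code s).+1 = size s.
Proof. by apply: trunc_log_eq => //; apply: code_bounds. Qed.

Lemma code_surj v : exists s, code s = v.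
Proof.
elim/ltn_ind: v => [[|v] IH]; first by exists [::].
have [|s hs] := IH v./2; first by lia.
by exists (rcons s (odd v)); rewrite code_rcons hs; lia.
Qed.

Lemma code_inj : injective code.
Proof.
elim/last_ind => [|s b IH]; elim/last_ind => [|s' b' _] //.
- by rewrite code_rcons.
- by rewrite code_rcons.
rewrite !code_rcons => h.
have [h1 h2] : code s = code s' /\ b = b' by case: b b' h => -[] /=; split; lia.
by rewrite (IH _ h1) h2.
Qed.

Definition decode (v : nat) : seq bool := projT1 (cid (code_surj v)).

Lemma decodeK v : code (decode v) = v.
Proof. by rewrite /decode; case: cid. Qed.

Lemma codeK s : decode (code s) = s.
Proof. by apply: code_inj; rewrite decodeK. Qed.

Lemma size_decode v : size (decode v) = trunc_log 2 v.+1.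
Proof. by rewrite -trunc_log_code decodeK. Qed.

(** The strings of length at most [n] thus correspond to an initial segment of the naturals, and
    sums over them become sums over codes. *)
Lemma code_lt_exp s n : (code s < (2 ^ n.+1).-1) = (size s <= n).
Proof.
have [h1 h2] := andP (code_bounds s).
have e0 : 0 < 2 ^ n.+1 by rewrite expn_gt0.
rewrite -ltnS prednK //; apply/idP/idP => h.
  by rewrite -ltnS -(@ltn_exp2l 2) //; apply: leq_ltn_trans h1 h.
by apply: leq_trans h2 _; rewrite leq_exp2l.
Qed.

(** [V] looks for the least time at which [Q] holds and outputs [O] at that time; the given [t] need
    not be the least one. *)
Lemma search_machine (Q : nat -> nat -> bool) (O : nat -> nat -> nat) :
  computableb 2 (fun l => Q (nth 0 l 0) (nth 0 l 1)) ->
  computable 2 (fun l => O (nth 0 l 0) (nth 0 l 1)) ->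
  exists V, machine V /\ forall p t, Q t (code p) ->
    exists t', [/\ t' <= t, Q t' (code p) & V p = Some (decode (O t' (code p)))].
Proof.
move=> /computableb_neg[pQ hQ] [pO hO].
have evQ t c : eval pQ [:: t; c] (~~ Q t c) by apply: hQ.
(* [machine] asks for an equivalence, so values must be unique: two results of one computation both
   appear in its fuel function, which is stable. *)
have det c t v : eval pQ [:: t; c] v -> v = ~~ Q t c.
  have [T [_ hT2 hT3]] := fueled_exists pQ 2.
  move=> /(hT3 [:: t; c] v erefl)[t1 h1].
  have [t2 h2] := (hT3 [:: t; c] _ erefl).1 (evQ t c).
  exact: (stable_eq (hT2 [:: t; c] erefl) h1 h2).
have detO c t v : eval pO [:: t; c] v -> v = O t c.
  have [T [_ hT2 hT3]] := fueled_exists pO 2.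
  move=> /(hT3 [:: t; c] v erefl)[t1 h1].
  have [t2 h2] := (hT3 [:: t; c] _ erefl).1 (hO [:: t; c] erefl).
  exact: (stable_eq (hT2 [:: t; c] erefl) h1 h2).
pose V p := if pselect (exists t, Q t (code p)) is left ex
  then Some (decode (O (ex_minn ex) (code p))) else None.
exists V; split; last first.
  move=> p t ht; rewrite /V; case: pselect => [ex|[]]; last by exists t.
  by case: ex_minnP => t' ht' hmin; exists t'; split => //; apply: hmin.
exists (MComp pO [:: MMu pQ; MProj 0]) => p v; split.
  move=> h.
  have [t ht hv] : exists2 t, eval (MMu pQ) [:: code p] t & eval pO [:: t; code p] v.
    have [ys hys hO'] : exists2 ys, List.Forall2 (fun g y => eval g [:: code p] y)
        [:: MMu pQ; MProj 0] ys & eval pO ys v by inversion h; exists ys.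
    inversion hys as [|? t ? ys1 ht hys1]; subst.
    inversion hys1 as [|? c ? ys2 hc hys2]; subst.
    by inversion hys2; subst; exists t => //; inversion hc; subst.
  have [/det h0 hlt] : eval pQ [:: t; code p] 0 /\
      (forall m, (m < t)%coq_nat -> exists k, eval pQ [:: m; code p] k.+1) by inversion ht.
  have hQt : Q t (code p) by case: (Q _ _) h0.
  rewrite (detO _ _ _ hv) /V; case: pselect => [ex|[]]; last by exists t.
  exists (decode (O (ex_minn ex) (code p))); split=> //; rewrite decodeK.
  case: ex_minnP => t' ht' hmin; congr O; apply/eqP; rewrite eqn_leq hmin // andbT.
  rewrite leqNgt; apply/negP => /ssrnat.ltP /hlt[k /det]; by rewrite ht'.
case=> y []; rewrite /V; case: pselect => // ex [<-] ->; rewrite decodeK.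
case: ex_minnP => t ht hmin.
apply: (eComp (ys := [:: t; code p])); last exact: (hO [:: t; code p] erefl).
constructor; last by constructor; [exact: (eProj 0 [:: code p])|constructor].
apply: eMu; first by have := evQ t (code p); rewrite ht.
move=> m /ssrnat.ltP hm; exists 0; have := evQ m (code p).
suff -> : Q m (code p) = false by [].
by apply/negP => /hmin; rewrite leqNgt hm.
Qed.

(** * Counting halting programs *)
Definition fuel_of (U : seq bool -> option (seq bool)) (TU : nat -> nat -> nat) : Prop :=
  [/\ computable 2 (fun l => TU (nth 0 l 0) (nth 0 l 1)), forall c, stable (TU^~ c) &
      forall c v, U (decode c) = Some (decode v) <-> exists t, TU t c = v.+1].

Lemma fuel_of_machine U : machine U -> exists TU, fuel_of U TU.
Proof.
move=> [p hp]; have [T [h1 h2 h3]] := fueled_exists p 1.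
exists (fun t c => T [:: t; c]); split=> [|c|c v].
- apply: (computable_seq_app h1); apply: computable_seq_cons; first exact: computable_nth.
  by apply: computable_seq_cons; [exact: computable_nth|exact: computable_seq_nil].
- exact: h2.
- rewrite -h3 //; have := hp (decode c) v; rewrite decodeK => ->.
  split=> [->|[y [-> ->]]]; last by rewrite codeK.
  by exists (decode v); rewrite decodeK.
Qed.

Lemma fuel_in_dom U TU c : fuel_of U TU ->
  in_dom U (decode c) <-> exists t, TU t c != 0.
Proof.
move=> [_ _ h]; split=> [[y hy]|[t ht]].
  have [|t ht] := (h c (code y)).1; first by rewrite codeK.
  by exists t; rewrite ht.
case E : (TU t c) ht => [//|v] _; exists (decode v); apply/h; by exists t.
Qed.

Lemma eventually_all N (P : nat -> nat -> Prop) :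
  (forall i, i < N -> exists t0, forall t, t0 <= t -> P i t) ->
  exists t0, forall t, t0 <= t -> forall i, i < N -> P i t.
Proof.
elim: N => [|N IH] h; first by exists 0.
have [i hi|t1 h1] := IH; first by apply: h; exact: ltnW.
have [t2 h2] := h N (ltnSn N).
exists (maxn t1 t2) => t ht i; rewrite ltnS leq_eqVlt => /orP[/eqP->|hi].
  by apply: h2; lia.
by apply: h1 => //; lia.
Qed.

Definition nhalt (U : seq bool -> option (seq bool)) (n : nat) : nat :=
  \sum_(0 <= c < (2 ^ n.+1).-1) `[< in_dom U (decode c) >].

Definition nhalt_fuel (TU : nat -> nat -> nat) (t n : nat) : nat :=
  \sum_(0 <= c < (2 ^ n.+1).-1) (TU t c != 0).

Lemma nhalt_fuel_eventually U TU n : fuel_of U TU ->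
  exists t0, forall t, t0 <= t -> nhalt_fuel TU t n = nhalt U n.
Proof.
move=> hU; have [_ st _] := hU.
have [c _|t0 h0] := @eventually_all (2 ^ n.+1).-1
    (fun c t => (TU t c != 0) = `[< in_dom U (decode c) >]).
  case: asboolP => [/(fuel_in_dom _ hU)[t0 h0]|hn].
    exists t0 => t ht; case E : (TU t0 c) h0 => [//|v] _.
    by rewrite (st c _ _ _ E ht).
  exists 0 => t _; apply/negbTE/negP => h; apply: hn; apply/(fuel_in_dom _ hU).
  by exists t.
by exists t0 => t /h0 h; apply: eq_big_nat => c /andP[_ /h ->].
Qed.

(** The programs that have stopped by time [t] are among the halting ones; if one were missing, the
    count at time [t] would be strictly smaller. *)
Lemma nhalt_fuel_full U TU n t c : fuel_of U TU -> nhalt_fuel TU t n = nhalt U n ->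
  c < (2 ^ n.+1).-1 -> in_dom U (decode c) -> TU t c != 0.
Proof.
move=> hU; rewrite /nhalt_fuel /nhalt !big_mkord => heq hc hdom; apply/negP => h0.
have := heq; rewrite (bigD1 (Ordinal hc)) //= [RHS](bigD1 (Ordinal hc)) //= h0 asboolT // add0n.
apply/eqP; rewrite neq_ltn; apply/orP; left; rewrite add1n ltnS.
apply: leq_sum => i _; case: eqP => //= /eqP hi; rewrite asboolT //.
by apply/(fuel_in_dom _ hU); exists t.
Qed.

(** The 2-adic valuation for [m > 0]. The number [2 ^ d * (2 * B).+1] carries the pair of [d] and
    [B] in only [d + 1] bits more than [B] has. *)
Definition val2 (m : nat) : nat := bmin (fun i => m %% 2 ^ i.+1 != 0) m.

Lemma val2_eq d B : val2 (2 ^ d * (2 * B).+1) = d.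
Proof.
have hd : d < 2 ^ d by apply: ltn_expl.
apply: bmin_eq; first by nia.
- rewrite expnSr -muln_modr // muln_eq0 negb_or expn_eq0 /=.
  by rewrite -addn1 mulnC modnMDl.
- by move=> j hj; rewrite negbK -(subnK hj) expnD -mulnA mulnCA modnMr.
Qed.

(* If [G t n d] is (a stable computation of) the number of halting programs of
   length at most [n] in units of [2 ^ (n - 2 d)], up to an error of a few units,
   then the exact number can be encoded in a program of length [n - d + O(1)],
   which then yields an object of complexity greater than [n]. *)
Lemma no_approx_count U (G : nat -> nat -> nat -> nat) :
  machine U -> optimal U ->
  computable 3 (fun l => G (nth 0 l 0) (nth 0 l 1) (nth 0 l 2)) ->
  (forall n d, stable (fun t => G t n d)) ->
  exists d, forall n t e, 2 * d <= n -> G t n d = e.+1 ->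
    e * 2 ^ (n - 2 * d) <= nhalt U n + 2 ^ (n - 2 * d) ->
    nhalt U n < (e + 3) * 2 ^ (n - 2 * d) -> False.
Proof.
move=> mU oU tcG stG; have [TU hU] := fuel_of_machine mU; have [tcTU stU evU] := hU.
(* A program with code [P] is read as [P.+1 = 2 ^ d * (2 * B).+1]. For the intended programs [B]
   lies between [4 * 2 ^ l] and [8 * 2 ^ l] with [l = n - 2 * d], so its bit length yields [l], and
   then [n]. *)
pose B P := P.+1 %/ 2 ^ (val2 P.+1) %/ 2.
pose l P := trunc_log 2 (B P) - 2.
pose n P := l P + 2 * val2 P.+1.
(* Wait until the count at time [t] is the one described by the estimate and [B]. Of the 5 units, 4
   cancel the leading part of [B], and 1 allows for an estimate that is too large. *)
pose Q t P := (G t (n P) (val2 P.+1) != 0) &&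
  (nhalt_fuel TU t (n P) + 5 * 2 ^ l P == (G t (n P) (val2 P.+1)).-1 * 2 ^ l P + B P).
(* [TU t c] is the output code plus one, so this sum exceeds the output code of every program of
   length at most [n P] that has stopped by time [t]. *)
pose O t P := \sum_(0 <= c < (2 ^ (n P).+1).-1) TU t c.
have tcQ : computableb 2 (fun l => Q (nth 0 l 0) (nth 0 l 1)).
  by rewrite /Q /nhalt_fuel /n /l /B /val2; computable_auto.
have tcO : computable 2 (fun l => O (nth 0 l 0) (nth 0 l 1)).
  by rewrite /O /n /l /B /val2; computable_auto.
have [V [mV hV]] := search_machine tcQ tcO.
have [c hc] := oU V mV.
(* The program [decode P0] has length [d + (n0 - 2 * d + 2) + 1 = n0 - d + 3]. This is [n0 - c],
   hence its translation for [U] has length at most [n0]. *)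
pose d := c + 3; exists d => n0 t0 e hn0 hG h1 h2.
set u := 2 ^ (n0 - 2 * d) in h1 h2.
pose b := nhalt U n0 + u - e * u.
have hb : b < 4 * u by rewrite /b; nia.
pose B0 := 4 * u + b; pose P0 := (2 ^ d * (2 * B0).+1).-1.
have hP0 : P0.+1 = 2 ^ d * (2 * B0).+1 by rewrite prednK // muln_gt0 expn_gt0.
have hv : val2 P0.+1 = d by rewrite hP0 val2_eq.
have hB : B P0 = B0.
  by rewrite /B hv hP0 mulKn ?expn_gt0 // -addn1 mulnC divnMDl // addn0.
have hu : 4 * u = 2 ^ (n0 - 2 * d + 2) by rewrite expnD mulnC.
have hlB : trunc_log 2 B0 = n0 - 2 * d + 2.
  by apply: trunc_log_eq => //; rewrite expnS -hu /B0; lia.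
have hl : l P0 = n0 - 2 * d by rewrite /l hB hlB addnK.
have hn : n P0 = n0 by rewrite /n hl hv subnK.
have hsz : size (decode P0) = n0 - c.
  rewrite size_decode hP0; apply: trunc_log_eq => //.
  have -> : n0 - c = d + (n0 - 2 * d + 2).+1 by rewrite /d in hn0 *; lia.
  have hd0 : 0 < 2 ^ d by rewrite expn_gt0.
  rewrite (expnS 2 (d + _)) !expnD !(expnS 2 (_ + _)) -hu /B0; nia.
have [tH hH] := nhalt_fuel_eventually n0 hU.
have hQ : Q (maxn t0 tH) (code (decode P0)).
  rewrite decodeK /Q hn hv hl (stG _ _ _ _ _ hG (leq_maxl _ _)) hH ?leq_maxr // hB /=.
  by rewrite /B0 /b -/u; lia.
have [t [_ ht hVt]] := hV _ _ hQ.
have [q [hUq hq]] := hc _ _ hVt.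
move: ht hUq hq; rewrite decodeK hsz /Q /O hn hv hl hB => /andP[].
case E : (G t n0 d) => [//|e'] _ /= /eqP ht.
(* The search may have stopped earlier than [maxn t0 tH], but the estimate seen at [t] is again [e],
   so the count at time [t] is exact. *)
rewrite (stable_eq (stG n0 d) E hG) in ht.
have hcnt : nhalt_fuel TU t n0 = nhalt U n0 by move: ht; rewrite /B0 /b -/u; lia.
set y := \sum_(_ <= _ < _) _ => hUq hq.
have hqn : code q < (2 ^ n0.+1).-1 by rewrite code_lt_exp; lia.
have hUq' : U (decode (code q)) = Some (decode y) by rewrite codeK.
have hdom : in_dom U (decode (code q)) by exists (decode y).
have := nhalt_fuel_full hU hcnt hqn hdom.
case Eq : (TU t (code q)) => [//|v] _.
have [t2 h2q] := (evU _ _).1 hUq'.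
have hvy : v = y := stable_eq (stU (code q)) Eq h2q.
(* [q] is itself one of the stopped programs, and its output code is [y]; so the sum [y] has the
   term [y.+1]. *)
have : TU t (code q) <= y by rewrite /y big_mkord (bigD1 (Ordinal hqn)) //= leq_addr.
by rewrite Eq hvy ltnn.
Qed.

(** * Probability of an answer *)

Local Open Scope ring_scope.
Lemma mem_strings_of_len k s : (s \in strings_of_len k) = (size s == k).
Proof.
elim: k s => [|k IH] [|b s] //=; rewrite !mem_cat in_nil orbF.
  by apply/negbTE; rewrite negb_or; apply/andP; split; apply/mapP => -[].
rewrite eqSS -IH; apply/orP/idP => [[]/mapP[s' h [_ ->]]//|h].
by case: b; [right|left]; apply/mapP; exists s.
Qed.

Lemma mem_strings_upto n s : (s \in strings_upto n) = (size s <= n)%nat.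
Proof.
apply/flatten_mapP/idP => [[k]|h].
  by rewrite mem_iota mem_strings_of_len => h /eqP ->.
by exists (size s); [rewrite mem_iota|rewrite mem_strings_of_len].
Qed.

Lemma size_strings_of_len k : size (strings_of_len k) = (2 ^ k)%nat.
Proof. by elim: k => // k IH; rewrite /= cats0 size_cat !size_map IH expnS mul2n addnn. Qed.

Lemma size_strings_upto n : size (strings_upto n) = (2 ^ n.+1).-1.
Proof.
rewrite /strings_upto size_flatten /shape -map_comp.
rewrite (eq_map (g := expn 2)); last exact: size_strings_of_len.
rewrite sumnE big_map -[iota 0 n.+1]/(index_iota 0 n.+1).
elim: n => [|n IH]; first by rewrite big_nat1.
rewrite big_nat_recr //= IH (expnS 2 n.+1).
have : (0 < 2 ^ n.+1)%nat by rewrite expn_gt0.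
lia.
Qed.

(** The codes cover [iota] and both lists have the same length, so there are no repetitions. *)
Lemma codes_strings_upto n :
  uniq (strings_upto n) /\ perm_eq [seq code s | s <- strings_upto n] (iota 0 (2 ^ n.+1).-1).
Proof.
have hs : {subset iota 0 (2 ^ n.+1).-1 <= [seq code s | s <- strings_upto n]}.
  move=> c; rewrite mem_iota add0n => /andP[_ hc]; apply/mapP; exists (decode c).
    by rewrite mem_strings_upto -code_lt_exp decodeK.
  by rewrite decodeK.
have hsz : (size [seq code s | s <- strings_upto n] <= size (iota 0 (2 ^ n.+1).-1))%nat.
  by rewrite size_map size_strings_upto size_iota.
have [_ hm] := uniq_min_size (iota_uniq _ _) hs hsz.
have hu := leq_size_uniq (iota_uniq _ _) hs hsz.
split; first exact: map_uniq hu.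
by apply: (uniq_perm hu (iota_uniq _ _)) => c; rewrite hm.
Qed.

Lemma sum_strings_upto (T : nmodType) (F : seq bool -> T) n :
  \sum_(s <- strings_upto n) F s = \sum_(0 <= c < (2 ^ n.+1).-1) F (decode c).
Proof.
rewrite /index_iota subn0 -(perm_big _ (codes_strings_upto n).2) big_map.
by apply: eq_bigr => s _; rewrite codeK.
Qed.

Lemma strings_upto_recl (T : nmodType) (F : seq bool -> T) n :
  \sum_(s <- strings_upto n.+1) F s =
  F [::] + (\sum_(s <- strings_upto n) F (false :: s) + \sum_(s <- strings_upto n) F (true :: s)).
Proof.
rewrite /strings_upto; move: n.+1 => m.
rewrite -[iota 0 m.+1]/(0%nat :: iota 1 m) map_cons /= big_cons; congr (_ + _).
have -> : iota 1 m = [seq k.+1 | k <- iota 0 m] by rewrite -(iotaDl 1 0).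
rewrite -map_comp !big_flatten !big_map /= -big_split.
by apply: eq_bigr => k _; rewrite /= cats0 big_cat !big_map.
Qed.

(** Kraft's inequality for prefix-free sets. If [S] contains the empty string, it contains nothing
    else; otherwise the strings with a given first bit contribute at most 1/2 by induction. *)
Lemma kraft (S : seq bool -> bool) n :
  (forall r k, S r -> (k < size r)%nat -> ~~ S (take k r)) ->
  \sum_(r <- strings_upto n | S r) (2^-1 : R) ^+ size r <= 1.
Proof.
elim: n S => [|n IH] S hS.
  by rewrite /strings_upto /= big_cons big_nil; case: (S [::]); rewrite ?addr0 ?expr0 ?ler01.
rewrite big_mkcond strings_upto_recl; case: ifP => h0.
  rewrite !big1 ?addr0 // => r _; case: ifP => // hr;
    by have := hS _ 0%nat hr isT; rewrite take0 h0.
have hb b : \sum_(r <- strings_upto n)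
    (if S (b :: r) then (2^-1 : R) ^+ size (b :: r) else 0) <= 2^-1.
  rewrite -big_mkcond /=; under eq_bigr do rewrite exprS.
  rewrite -mulr_sumr -[leRHS]mulr1 ler_pM2l ?invr_gt0 ?ltr0n //; apply: IH => r k hr hk.
  exact: (hS _ k.+1 hr).
rewrite add0r; have := lerD (hb false) (hb true); move/le_trans; apply; lra.
Qed.

(** Removing the last bit halves [(code r).+1], so prefixes can be computed arithmetically on
    codes. *)
Lemma take_code r i : (i <= size r)%nat ->
  code (take (size r - i) r) = ((code r).+1 %/ 2 ^ i).-1.
Proof.
elim/last_ind: r i => [|r b IH] [|i] //=; rewrite ?subn0 ?take_size ?divn1 //.
rewrite size_rcons ltnS => hi.
rewrite subSS -cats1 takel_cat ?leq_subr // IH // cats1 code_rcons expnS divnMA.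
by congr (_ %/ _).-1; case: b; lia.
Qed.

(** * Step-bounded runs of randomized algorithms *)

Definition fuel_of_alg (A : seq bool -> seq bool -> option (option (seq bool)))
  (TA : nat -> nat -> nat -> nat) : Prop :=
  [/\ computable 3 (fun l => TA (nth 0 l 0) (nth 0 l 1) (nth 0 l 2))%nat,
      forall c r, stable (fun t => TA t c r),
      forall x r, A x r = Some None <-> exists t, TA t (code x) (code r) = 1%nat &
      forall x r y, A x r = Some (Some y) <-> exists t, TA t (code x) (code r) = (code y).+2].

Lemma fuel_of_rand_alg A : rand_alg A -> exists TA, fuel_of_alg A TA.
Proof.
move=> [p hp]; have [T [h1 h2 h3]] := fueled_exists p 2.
exists (fun t c r => T [:: t; c; r]); split=> [|c r|x r|x r y].
- apply: (computable_seq_app h1); apply: computable_seq_cons; first exact: computable_nth.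
  apply: computable_seq_cons; first exact: computable_nth.
  by apply: computable_seq_cons; [exact: computable_nth|exact: computable_seq_nil].
- exact: h2.
- rewrite -h3 // hp; split=> [->|[[]//|[y [_]]//]]; by left.
- rewrite -h3 // hp; split=> [->|[[_]//|[z [-> [/code_inj->]]]//]]; by right; exists y.
Qed.

(** By [take_code], the second conjunct runs over the proper prefixes of the string coded by [r];
    after each of them the algorithm must have asked for another bit, which is the value 1. *)
Definition halted (TA : nat -> nat -> nat -> nat) (s c r v : nat) : bool :=
  (TA s c r == v) &&
  all (fun i => TA s c (r.+1 %/ 2 ^ i.+1).-1 == 1%nat) (iota 0 (trunc_log 2 r.+1)).

Lemma halted_halts_with A TA s x r y : fuel_of_alg A TA ->
  halted TA s (code x) (code r) (code y).+2 -> halts_with A x r y.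
Proof.
move=> [_ _ hask hhalt] /andP[/eqP h1 /allP h2]; split; first by apply/hhalt; exists s.
move=> k hk; apply/hask; exists s.
have := h2 (size r - k.+1)%nat; rewrite mem_iota trunc_log_code add0n /=.
have -> : (size r - k.+1).+1 = (size r - k)%nat by lia.
rewrite -take_code ?leq_subr // subKn ?(ltnW hk) // => h.
by apply/eqP/h; lia.
Qed.

Lemma halts_with_halted A TA x r y : fuel_of_alg A TA -> halts_with A x r y ->
  exists s0, forall s, (s0 <= s)%nat -> halted TA s (code x) (code r) (code y).+2.
Proof.
move=> [_ st hask hhalt] [/hhalt[t1 ht1] h2].
have [i hi|t2 ht2] := @eventually_all (size r) (fun i t =>
    TA t (code x) ((code r).+1 %/ 2 ^ i.+1).-1 = 1%nat).
  have /hask[t0 ht0] : A x (take (size r - i.+1) r) = Some None by apply: h2; lia.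
  exists t0 => t htt; apply: (st _ _ t0) => //; by rewrite -take_code.
exists (maxn t1 t2) => s hs; apply/andP; split.
  by apply/eqP; apply: (st _ _ _ _ _ ht1); lia.
apply/allP => i; rewrite mem_iota trunc_log_code add0n => /andP[_ hi].
by apply/eqP/ht2 => //; lia.
Qed.

(** [2 ^ s] times the probability of a result [v] within fuel [s] and at most [s] coin bits; the
    scaling makes it an integer. *)
Definition weight (TA : nat -> nat -> nat -> nat) (v s c : nat) : nat :=
  \sum_(0 <= r < (2 ^ s.+1).-1) (halted TA s c r v : nat) * 2 ^ (s - trunc_log 2 r.+1).

Lemma weightE TA v s c : (weight TA v s c)%:R / 2 ^+ s =
  \sum_(r <- strings_upto s | halted TA s c (code r) v) (2^-1 : R) ^+ size r.
Proof.
rewrite big_mkcond sum_strings_upto /weight natr_sum mulr_suml.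
apply: eq_big_nat => r /andP[_ hr]; rewrite decodeK size_decode.
case: halted; last by rewrite mul0n mul0r.
have hl : (trunc_log 2 r.+1 <= s)%nat.
  by rewrite -size_decode -code_lt_exp decodeK.
rewrite mul1n natrX -[in X in _ / X](subnK hl) exprD invfM mulrA divff ?expf_neq0 //.
by rewrite mul1r exprVn.
Qed.

(** A finite sum between [weight] and [prob]: the number of coin bits is bounded, the running time
    is not. *)
Definition halt_mass (A : seq bool -> seq bool -> option (option (seq bool)))
  (s : nat) (x y : seq bool) : R :=
  \sum_(r <- strings_upto s | `[< halts_with A x r y >]) (2^-1 : R) ^+ size r.

Lemma pow_half_ge0 n : 0 <= (2^-1 : R) ^+ n.
Proof. by rewrite exprn_ge0 // invr_ge0 ler0n. Qed.

Lemma weight_halt_mass A TA s x y : fuel_of_alg A TA ->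
  (weight TA (code y).+2 s (code x))%:R / 2 ^+ s <= halt_mass A s x y.
Proof.
move=> hA; rewrite weightE /halt_mass big_mkcond [leRHS]big_mkcond; apply: ler_sum => r _.
case: ifP => h; last by case: ifP => // _; exact: pow_half_ge0.
by rewrite asboolT //; apply: halted_halts_with h.
Qed.

Lemma finite_halt_mass A s x y (F : seq (seq bool)) : uniq F ->
  (forall r, r \in F -> halts_with A x r y /\ (size r <= s)%nat) ->
  \sum_(r <- F) (2^-1 : R) ^+ size r <= halt_mass A s x y.
Proof.
move=> uF hF; have hp : perm_eq F [seq r <- strings_upto s | r \in F].
  apply: uniq_perm => //; first exact: filter_uniq (codes_strings_upto s).1.
  move=> r; rewrite mem_filter mem_strings_upto; case E : (r \in F) => //=.
  by have [_ ->] := hF r E.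
rewrite (perm_big _ hp) big_filter /halt_mass big_mkcond [leRHS]big_mkcond.
apply: ler_sum => r _; case: ifP => h; last by case: ifP => // _; exact: pow_half_ge0.
by rewrite asboolT //; have [] := hF r h.
Qed.

(** The coin strings leading to [y] and those leading to [z] are disjoint, and together they form a
    prefix-free set. *)
Lemma halt_mass_two A s x y z : y != z -> halt_mass A s x y + halt_mass A s x z <= 1.
Proof.
move=> hyz; apply: le_trans (@kraft
  (fun r => `[< halts_with A x r y >] || `[< halts_with A x r z >]) s _).
  rewrite /halt_mass !(big_mkcond (fun r => `[< _ >])) -big_split [leRHS]big_mkcond /=.
  apply: ler_sum => r _; case: asboolP => [[h1 _]|h1]; case: asboolP => [[h2 _]|h2] /=.
  - by move: hyz; move: h2; rewrite h1 => -[->]; rewrite eqxx.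
  - by rewrite addr0.
  - by rewrite add0r.
  - by rewrite addr0.
move=> r k hr hk; have hn : A x (take k r) = Some None.
  by case/orP: hr => /asboolP[_]; apply.
by rewrite negb_or; apply/andP; split; apply/negP => /asboolP[]; rewrite hn.
Qed.

Lemma fsets_halt_mass A x y X : fsets [set r | halts_with A x r y]%classic X ->
  exists F : seq (seq bool), [/\ uniq F, forall r, r \in F -> halts_with A x r y &
   (\sum_(r \in X) ((2^-1 : R) ^+ size r)%:E = (\sum_(r <- F) (2^-1 : R) ^+ size r)%:E)%E].
Proof.
move=> [finX subX]; exists (finmap.enum_fset (fset_set X)); split; first exact: finmap.fset_uniq.
  by move=> r; rewrite in_fset_set // inE => /subX.
by rewrite fsbig_finite // sumEFin.
Qed.

Lemma finite_size_bound (F : seq (seq bool)) : exists s, forall r, r \in F -> (size r <= s)%nat.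
Proof.
exists (\max_(r <- F) size r)%nat => r hr; exact: leq_bigmax_seq.
Qed.

Lemma esum_halts_le1 A x y :
  (\esum_(r in [set r | halts_with A x r y]%classic) ((2^-1 : R) ^+ size r)%:E <= 1%:E)%E.
Proof.
apply: ge_ereal_sup => _ [X /fsets_halt_mass[F [uF hF ->]] <-]; rewrite lee_fin.
have [s hs] := finite_size_bound F.
apply: (@le_trans _ _ (halt_mass A s x y)).
  by apply: finite_halt_mass => // r hr; split; [exact: hF|exact: hs].
(* Any second output will do; its mass is then dropped. *)
have hn : y != true :: y by apply/eqP => /(congr1 size) /= ; lia.
apply: le_trans (halt_mass_two A s x hn).
by rewrite lerDl /halt_mass sumr_ge0 // => r _; exact: pow_half_ge0.
Qed.

Lemma prob_esum A x y :
  ((prob A x y)%:E = \esum_(r in [set r | halts_with A x r y]%classic) ((2^-1 : R) ^+ size r)%:E)%E.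
Proof.
rewrite /prob fineK // ge0_fin_numE.
  by apply: le_lt_trans (esum_halts_le1 A x y) _; rewrite ltry.
by apply: esum_ge0 => r _; rewrite lee_fin pow_half_ge0.
Qed.

Lemma halt_mass_prob A s x y : halt_mass A s x y <= prob A x y.
Proof.
rewrite -lee_fin prob_esum; apply: esum_ge.
pose F := [seq r <- strings_upto s | `[< halts_with A x r y >]].
have hF r : r \in F -> halts_with A x r y by rewrite mem_filter => /andP[/asboolP].
exists [set` F]%classic; first by split; [exact: finite_seq|move=> r /hF].
rewrite -fsbig_seq ?filter_uniq ?(codes_strings_upto s).1 //.
by rewrite sumEFin lee_fin /F big_filter.
Qed.

(** Finitely many coin strings carry the probability up to [e], and each of them is recognized by
    [halted] from some time on. *)
Lemma prob_weight A TA x y (e : R) : fuel_of_alg A TA -> 0 < e ->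
  exists s0, forall s, (s0 <= s)%nat ->
    prob A x y - e <= (weight TA (code y).+2 s (code x))%:R / 2 ^+ s.
Proof.
move=> hA e0.
have : ((prob A x y - e)%:E < \esum_(r in [set r | halts_with A x r y]%classic)
    ((2^-1 : R) ^+ size r)%:E)%E by rewrite -prob_esum lte_fin ltrBlDr ltrDl.
move=> /ereal_sup_gt[_ [X /fsets_halt_mass[F [uF hF ->]] <-]]; rewrite lte_fin => hlt.
have [b hb] := finite_size_bound F.
have [i hi|s0 hs0] := @eventually_all (size F) (fun i s =>
    halted TA s (code x) (code (nth [::] F i)) (code y).+2).
  by apply: halts_with_halted hA _; apply: hF; exact: mem_nth.
exists (maxn b s0) => s hs; apply/ltW/(lt_le_trans hlt); rewrite weightE.
have hp : perm_eq F [seq r <- strings_upto s | r \in F].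
  apply: uniq_perm => //; first exact: filter_uniq (codes_strings_upto s).1.
  move=> r; rewrite mem_filter mem_strings_upto; case E : (r \in F) => //=.
  by rewrite (leq_trans (hb r E)) // (leq_trans _ hs) // leq_maxl.
rewrite (perm_big _ hp) big_filter big_mkcond [leRHS]big_mkcond.
apply: ler_sum => r _; case: ifP => h; last by case: ifP => // _; exact: pow_half_ge0.
rewrite -(nth_index [::] h) hs0 ?index_mem //; lia.
Qed.

(** * Approximating the count by a randomized algorithm *)
Lemma prob_two A TA x y z : fuel_of_alg A TA -> y != z -> prob A x y + prob A x z <= 1.
Proof.
move=> hA hyz; rewrite leNgt; apply/negP => h.
pose e := (prob A x y + prob A x z - 1) / 3.
have e0 : 0 < e by rewrite /e; lra.
have [s1 h1] := prob_weight x y hA e0; have [s2 h2] := prob_weight x z hA e0.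
have := h1 _ (leq_maxl s1 s2); have := h2 _ (leq_maxr s1 s2).
have := weight_halt_mass (maxn s1 s2) x y hA; have := weight_halt_mass (maxn s1 s2) x z hA.
have := halt_mass_two A (maxn s1 s2) x hyz.
rewrite /e; lra.
Qed.

Lemma weight_prob A TA s x y : fuel_of_alg A TA ->
  (weight TA (code y).+2 s (code x))%:R / 2 ^+ s <= prob A x y.
Proof. move=> hA; exact: le_trans (weight_halt_mass s x y hA) (halt_mass_prob A s x y). Qed.

Lemma weight_ge0 TA v s c : 0 <= (weight TA v s c)%:R / 2 ^+ s :> R.
Proof. by rewrite divr_ge0 // ?exprn_ge0 ?ler0n. Qed.

(* The subtraction in [err_prob] is the one of Stdlib's reals. *)
Lemma err_probE U A x : err_prob U A x = 1 - prob A x (answer U x).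
Proof. by []. Qed.

(** The mass of the wrong answer never exceeds the error probability; the remaining discrepancy is
    the mass [1 - py - pn] still undecided at time [s]. *)
Lemma indicator_err U A TA s x : fuel_of_alg A TA ->
  let py := (weight TA 4 s (code x))%:R / 2 ^+ s in
  let pn := (weight TA 3 s (code x))%:R / 2 ^+ s in
  - err_prob U A x <= (`[< in_dom U x >])%:R - py <= (1 - py - pn) + err_prob U A x.
Proof.
move=> hA /=.
have hy : (weight TA 4 s (code x))%:R / 2 ^+ s <= prob A x [:: true] := weight_prob s x [:: true]
  hA.
have hn : (weight TA 3 s (code x))%:R / 2 ^+ s <= prob A x [:: false] := weight_prob s x [:: false]
  hA.
have h2 : prob A x [:: true] + prob A x [:: false] <= 1 by apply: prob_two hA _.
have := weight_ge0 TA 4 s (code x); have := weight_ge0 TA 3 s (code x).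
rewrite err_probE /answer; case: asboolP => _ h3 h4; rewrite ?mulr1n ?mulr0n; apply/andP; split;
  lra.
Qed.

Definition total_err U A n : R := \sum_(x <- strings_upto n) err_prob U A x.

Definition weight_sum (TA : nat -> nat -> nat -> nat) (v s n : nat) : nat :=
  \sum_(0 <= c < (2 ^ n.+1).-1) weight TA v s c.

Lemma weight_sumE TA v s n : (weight_sum TA v s n)%:R / 2 ^+ s =
  \sum_(x <- strings_upto n) ((weight TA v s (code x))%:R / 2 ^+ s) :> R.
Proof.
rewrite sum_strings_upto /weight_sum natr_sum mulr_suml.
by apply: eq_bigr => c _; rewrite decodeK.
Qed.

Lemma nhalt_sum U n : (nhalt U n)%:R = \sum_(x <- strings_upto n) (`[< in_dom U x >])%:R :> R.
Proof. by rewrite sum_strings_upto /nhalt natr_sum. Qed.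

(* The answers 1 and 0 have codes 2 and 1, hence they appear as 4 and 3. *)
Definition answered (TA : nat -> nat -> nat -> nat) (s n d : nat) : bool :=
  (2 * (2 ^ n.+1).-1 * 2 ^ s <=
    2 ^ (n - 2 * d) * 2 ^ s + 2 * (weight_sum TA 4 s n + weight_sum TA 3 s n))%nat.

(** The expected number of answers 1 found by time [s], in units of [2 ^ (n - 2 * d)], rounded
    down. *)
Definition estimate (TA : nat -> nat -> nat -> nat) (s n d : nat) : nat :=
  (weight_sum TA 4 s n %/ (2 ^ s * 2 ^ (n - 2 * d)))%nat.

Lemma size_strings_uptoR (c : R) n :
  \sum_(x <- strings_upto n) c = ((2 ^ n.+1).-1)%:R * c.
Proof.
by rewrite sum_strings_upto big_mkord sumr_const card_ord mulr_natl.
Qed.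

(** The total error and, by [answered], the undecided mass are each at most half a unit, so the
    count exceeds the expected number of answers 1 by at most one unit and falls short of it by at
    most half. Rounding costs less than one more unit. *)
Lemma estimate_approx U A TA s n d : fuel_of_alg A TA -> answered TA s n d ->
  total_err U A n <= (2 ^ (n - 2 * d))%:R / 2 ->
  (estimate TA s n d * 2 ^ (n - 2 * d) <= nhalt U n + 2 ^ (n - 2 * d))%nat /\
  (nhalt U n < (estimate TA s n d + 3) * 2 ^ (n - 2 * d))%nat.
Proof.
move=> hA; rewrite /answered /estimate => hw hE.
set u := (2 ^ (n - 2 * d))%nat in hw hE *; set M := (2 ^ n.+1).-1 in hw.
set W4 := weight_sum TA 4 s n in hw *; set W3 := weight_sum TA 3 s n in hw.
set e := (W4 %/ _)%nat.
have p0 : 0 < 2 ^+ s :> R by rewrite exprn_gt0 ?ltr0n.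
have u0 : (0 < u)%nat by rewrite expn_gt0.
have q0 : (0 < 2 ^ s * u)%nat by rewrite muln_gt0 expn_gt0.
have u0R : 0 < u%:R :> R by rewrite ltr0n.
have he1 : (e * u)%:R <= W4%:R / 2 ^+ s :> R.
  rewrite ler_pdivlMr // -natrX -natrM ler_nat -mulnA (mulnC u).
  exact: leq_divM.
have he2 : W4%:R / 2 ^+ s < ((e + 1) * u)%:R :> R.
  rewrite ltr_pdivrMr // -natrX -natrM ltr_nat -mulnA (mulnC u) addn1.
  exact: ltn_ceil.
have hw' : M%:R - W4%:R / 2 ^+ s - W3%:R / 2 ^+ s <= u%:R / 2 :> R.
  have : (2 * M * 2 ^ s)%:R <= (u * 2 ^ s + 2 * (W4 + W3))%:R :> R by rewrite ler_nat.
  rewrite natrD !natrM natrD natrX => h.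
  have e4 : W4%:R = W4%:R / 2 ^+ s * 2 ^+ s :> R by rewrite divfK // gt_eqF.
  have e3 : W3%:R = W3%:R / 2 ^+ s * 2 ^+ s :> R by rewrite divfK // gt_eqF.
  rewrite -(ler_pM2r p0); move: h; rewrite {1}e4 {1}e3; nra.
have : - total_err U A n <= (nhalt U n)%:R - W4%:R / 2 ^+ s <=
    (M%:R - W4%:R / 2 ^+ s - W3%:R / 2 ^+ s) + total_err U A n.
  rewrite nhalt_sum !weight_sumE /total_err -[M%:R]mulr1 -size_strings_uptoR.
  rewrite -sumrN -!sumrB -big_split /=; apply/andP; split; apply: ler_sum => x _;
    by have /andP[] := indicator_err U s x hA.
move=> /andP[h1 h2]; split.
  rewrite -(ler_nat R) natrD; lra.
rewrite -(ltr_nat R); apply: (@lt_trans _ _ (((e + 1) * u)%:R + u%:R)); first lra.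
rewrite -natrD ltr_nat; nia.
Qed.

Lemma answered_eventually U A TA n d : fuel_of_alg A TA ->
  total_err U A n < (2 ^ (n - 2 * d))%:R / 2 ->
  exists s0, forall s, (s0 <= s)%nat -> answered TA s n d.
Proof.
move=> hA hE; set M := (2 ^ n.+1).-1; set u := (2 ^ (n - 2 * d))%nat in hE.
have M0 : 0 < M%:R :> R.
  have h : (0 < 2 ^ n)%nat by rewrite expn_gt0.
  by rewrite ltr0n /M expnS; lia.
(* The slack in the strict inequality is divided equally among the [M] inputs; on each, the weight
   of the correct answer may miss its limit by [e]. *)
pose e := (u%:R / 2 - total_err U A n) / M%:R.
have e0 : 0 < e by rewrite divr_gt0 // subr_gt0.
have [c hc|s0 hs0] := @eventually_all M (fun c s => 1 - err_prob U A (decode c) - e <=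
    (weight TA 4 s c)%:R / 2 ^+ s + (weight TA 3 s c)%:R / 2 ^+ s).
  rewrite err_probE /answer; case: asboolP => _.
    have [s0 h0] := prob_weight (decode c) [:: true] hA e0; exists s0 => s /h0.
    by rewrite decodeK; have := weight_ge0 TA 3 s c; rewrite /=; lra.
  have [s0 h0] := prob_weight (decode c) [:: false] hA e0; exists s0 => s /h0.
  by rewrite decodeK; have := weight_ge0 TA 4 s c; rewrite /=; lra.
exists s0 => s hs; rewrite /answered -/M -/u.
have p0 : 0 < 2 ^+ s :> R by rewrite exprn_gt0 ?ltr0n.
set W4 := weight_sum TA 4 s n; set W3 := weight_sum TA 3 s n.
have hsum : M%:R - total_err U A n - M%:R * e <= W4%:R / 2 ^+ s + W3%:R / 2 ^+ s.
  rewrite !weight_sumE /total_err -{1}[M%:R]mulr1 -!size_strings_uptoR -!sumrB -big_split /=.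
  rewrite !sum_strings_upto; apply: ler_sum_nat => c /andP[_ hc].
  by rewrite decodeK; apply: hs0.
have hMe : M%:R * e = u%:R / 2 - total_err U A n by rewrite /e mulrC divfK // gt_eqF.
rewrite -(ler_nat R) natrD !natrM natrD natrX.
have e4 : W4%:R = W4%:R / 2 ^+ s * 2 ^+ s :> R by rewrite divfK // gt_eqF.
have e3 : W3%:R = W3%:R / 2 ^+ s * 2 ^+ s :> R by rewrite divfK // gt_eqF.
rewrite e4 e3; rewrite hMe in hsum; nra.
Qed.

Lemma computableb_answered TA d k f g : computable 3 (fun l => TA (nth 0 l 0) (nth 0 l 1) (nth 0 l
  2))%nat ->
  computable k f -> computable k g -> computable k d -> computableb k (fun l => answered TA (f l)
    (g l) (d l)).
Proof.
move=> hTA; apply: (@computable_comp3 k (fun s n d => answered TA s n d)).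
by rewrite /answered /weight_sum /weight /halted; computable_auto.
Qed.

Lemma computable_estimate TA d k f g : computable 3 (fun l => TA (nth 0 l 0) (nth 0 l 1) (nth 0 l
  2))%nat ->
  computable k f -> computable k g -> computable k d -> computable k (fun l => estimate TA (f l) (g
    l) (d l)).
Proof.
move=> hTA; apply: (@computable_comp3 k (fun s n d => estimate TA s n d)).
by rewrite /estimate /weight_sum /weight /halted; computable_auto.
Qed.

(** * The two bounds *)
Lemma epsE U A n : eps U A n = total_err U A n / ((2 ^ n.+1).-1)%:R.
Proof. by rewrite /eps size_strings_upto RdivE. Qed.

(** There are fewer than [2 ^ n.+1] inputs, and [2 ^ n.+1] divided by [2 ^ (2 * d + 2)] is half of
    [2 ^ (n - 2 * d)]. *)
Lemma total_err_small U A n d : (2 * d <= n)%nat -> eps U A n < 2^-1 ^+ (2 * d + 2) ->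
  total_err U A n < (2 ^ (n - 2 * d))%:R / 2.
Proof.
move=> hn; rewrite epsE.
have h : (0 < 2 ^ n)%nat by rewrite expn_gt0.
have hM : (0 < (2 ^ n.+1).-1)%nat by rewrite expnS; lia.
rewrite ltr_pdivrMr ?ltr0n // => /lt_le_trans; apply.
have -> : (2 ^ (n - 2 * d))%:R / 2 = 2^-1 ^+ (2 * d + 2) * (2 ^ n.+1)%:R :> R.
  have -> : n.+1 = (2 * d + 2 + (n - 2 * d) - 1)%nat by lia.
  rewrite !natrX -addnBAC ?addnK; last by lia.
  have -> : (2 * d + 2 - 1 = (2 * d).+1)%nat by lia.
  rewrite addn2 exprS !exprVn exprD; field.
  by rewrite expf_neq0.
by rewrite ler_wpM2l ?exprn_ge0 ?invr_ge0 ?ler0n // ler_nat leq_pred.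
Qed.

Lemma limn_esup_lt (u : nat -> \bar R) (e : \bar R) : (limn_esup u < e)%E ->
  exists N, forall n, (N <= n)%nat -> (u n < e)%E.
Proof.
rewrite /limn_esup /limf_esup => /ereal_inf_lt[_ [V [N _ hN] <-] hlt].
exists N => n hn; apply: le_lt_trans hlt; apply: ereal_sup_ubound.
by exists n => //; apply: hN.
Qed.

Lemma limn_einf_ge (u : nat -> \bar R) (e : \bar R) N :
  (forall n, (N <= n)%nat -> (e <= u n)%E) -> (e <= limn_einf u)%E.
Proof.
move=> h; rewrite -[limn_einf u]/(limf_einf u \oo) limf_einfE.
apply: (@le_trans _ _ (ereal_inf (u @` [set n | (N <= n)%nat])%classic)).
  by apply/ereal_infP => _ [n hn <-]; exact: h.
by apply: ereal_sup_ubound; exists [set n | (N <= n)%nat]%classic => //; exists N.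
Qed.

(** Estimates vary with time; taking the one at the first time when [P] holds makes the result
    stable. *)
Lemma stable_first (P : nat -> bool) (f : nat -> nat) :
  stable (fun t => if P (bmin P t) then (f (bmin P t)).+1 else 0%nat).
Proof.
move=> t t' v; case: ifP => // hP hv htt.
suff -> : bmin P t' = bmin P t by rewrite hP.
apply: bmin_eq => //; first exact: leq_trans (bmin_leq _ _) htt.
by move=> j; apply: bmin_before.
Qed.

(** [G] is built from [A], so [d] depends on [A]; the error is at least [2^-1 ^+ (2 * d + 2)] for
    every [n >= 2 * d]. *)
Lemma E_inf_gt0 U A : machine U -> optimal U -> rand_alg A -> (0 < E_inf U A)%E.
Proof.
move=> mU oU /fuel_of_rand_alg[TA hA]; have [tcTA _ _ _] := hA.
pose first_answered t n d := bmin (fun i => answered TA i n d) t.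
pose G t n d := if answered TA (first_answered t n d) n d
  then (estimate TA (first_answered t n d) n d).+1 else 0%nat.
have tcF k f g h : computable k f -> computable k g -> computable k h ->
    computable k (fun l => first_answered (f l) (g l) (h l)).
  apply: (@computable_comp3 k first_answered).
  by apply: (@computable_bmin 3 _ (fun i l => answered TA i (nth 0%nat l 1) (nth 0%nat l 2)));
    [exact: computable_nth|apply: computableb_answered => //; computable_proj].
have [|n d|d hd] := @no_approx_count U G mU oU.
- apply: computable_if; [apply:
  computableb_answered|apply/computable_succ/computable_estimate|exact: computable_const] => //;
    by [computable_proj|apply: tcF; computable_proj].
- exact: (@stable_first (fun i => answered TA i n d) (fun i => estimate TA i n d)).
apply: (@lt_le_trans _ _ (2^-1 ^+ (2 * d + 2))%:E).
  by rewrite lte_fin exprn_gt0 // invr_gt0 ltr0n.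
apply: (@limn_einf_ge _ _ (2 * d)) => n hn; rewrite lee_fin leNgt; apply/negP.
move=> /(total_err_small hn) hE.
have [s0 hs0] := answered_eventually hA hE.
have ha : answered TA (first_answered s0 n d) n d 
  by apply: (@bmin_true (fun i => answered TA i n d) _ _ (leqnn s0)); apply: hs0.
have [h1 h2] := estimate_approx hA ha (ltW hE).
by apply: (hd n s0 _ hn _ h1 h2); rewrite /G ha.
Qed.

Lemma sum_digits_lt (e : nat -> nat) b N : (forall i, (i < N)%nat -> (e i < b)%nat) ->
  (\sum_(0 <= i < N) e i * b ^ i < b ^ N)%nat.
Proof.
elim: N => [|N IH] h; first by rewrite big_geq.
rewrite big_nat_recr //= expnS.
have := IH (fun i hi => h i (ltnW hi)); have := h N (ltnSn N).
set S := (\sum_(_ <= _ < _) _)%nat; nia.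
Qed.

Lemma digitE (e : nat -> nat) b N j : (forall i, (i < N)%nat -> (e i < b)%nat) -> (j < N)%nat ->
  ((\sum_(0 <= i < N) e i * b ^ i) %/ b ^ j %% b)%nat = e j.
Proof.
elim: N => // N IH h hj; rewrite big_nat_recr //=.
have b0 : (0 < b)%nat by have := h j hj; lia.
have hbj : (0 < b ^ j)%nat by rewrite expn_gt0 b0.
move: hj; rewrite ltnS leq_eqVlt => /orP[/eqP->|hj].
  rewrite addnC divnMDl ?expn_gt0 ?b0 //.
  rewrite divn_small ?addn0; first exact: modn_small (h N (ltnSn N)).
  exact: sum_digits_lt (fun i hi => h i (ltnW hi)).
have -> : (e N * b ^ N = e N * b ^ (N - j.+1) * b * b ^ j)%nat.
  by rewrite -!mulnA -expnS -expnD subnK.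
rewrite addnC divnMDl // modnMDl; apply: IH => // i hi; exact: h (ltnW hi).
Qed.

(** Ensures that an estimate fits into one digit in base [2 ^ (2 * d + 2)]: the count is at most
    [2 ^ (2 * d).+1] units. *)
Lemma estimate_lt U TA s n d : (2 * d <= n)%nat ->
  (estimate TA s n d * 2 ^ (n - 2 * d) <= nhalt U n + 2 ^ (n - 2 * d))%nat ->
  (estimate TA s n d < 2 ^ (2 * d + 2))%nat.
Proof.
move=> hn; have hle : (nhalt U n <= 2 ^ n.+1)%nat.
  apply: leq_trans (leq_pred _); rewrite /nhalt big_mkord.
  apply: (@leq_trans (\sum_(i < (2 ^ n.+1).-1) 1)).
    by apply: leq_sum => i _; case: asbool.
  by rewrite sum_nat_const card_ord muln1.
have hpow : (2 ^ n.+1 = 2 ^ (2 * d).+1 * 2 ^ (n - 2 * d))%nat by rewrite -expnD addSn subnKC.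
have h1 : (0 < 2 ^ (n - 2 * d))%nat by rewrite expn_gt0.
have h2 : (1 < 2 ^ (2 * d).+1)%nat by rewrite -[1%nat]/(2 ^ 0)%nat ltn_exp2l.
rewrite addn2 (expnS 2 (2 * d).+1); rewrite hpow in hle; nia.
Qed.

(* The approximations for all [n] in [[2^K, 2^K.+1)] are packed as the digits of
   the output of a program [q] of [U] with [code q < 2^K]; then [n = 2^K + code q]
   comes with its own approximation. *)
Lemma E_sup_uniform U : machine U -> optimal U ->
  exists e : R, 0 < e /\ forall A, rand_alg A -> (e%:E <= E_sup U A)%E.
Proof.
move=> mU oU; have [TU hU] := fuel_of_machine mU; have [tcTU stU evU] := hU.
(* [j n] is [n] without its leading binary digit. [G] runs the [U]-program coded by [j n] and reads
   digit number [j n] of its output; as [A] does not occur, [d] is fixed before [A] is given. *)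
pose j n := (n - 2 ^ trunc_log 2 n)%nat.
pose G t n d := if TU t (j n) == 0%nat then 0%nat
  else ((TU t (j n)).-1 %/ (2 ^ (2 * d + 2)) ^ j n %% 2 ^ (2 * d + 2)).+1.
have [|n d t t' v|d hd] := @no_approx_count U G mU oU.
- by rewrite /G /j; computable_auto.
- rewrite /G; case E : (TU t (j n)) => [//|w] hv htt.
  by rewrite (stU (j n) _ _ _ E htt).
exists (2^-1 ^+ (2 * d + 2)); split; first by rewrite exprn_gt0 // invr_gt0 ltr0n.
move=> A /fuel_of_rand_alg[TA hA]; have [tcTA _ _ _] := hA.
rewrite leNgt; apply/negP => /limn_esup_lt[N hN].
have hgood n : (N <= n)%nat -> (2 * d <= n)%nat ->
    total_err U A n < (2 ^ (n - 2 * d))%:R / 2.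
  by move=> h1 h2; apply: total_err_small => //; have := hN n h1; rewrite lte_fin.
pose b := (2 ^ (2 * d + 2))%nat.
pose Q t K := all (fun i => answered TA t (2 ^ K + i) d) (iota 0 (2 ^ K)).
pose O t K := (\sum_(0 <= i < 2 ^ K) estimate TA t (2 ^ K + i) d * b ^ i)%nat.
have tcQ : computableb 2 (fun l => Q (nth 0%nat l 0) (nth 0%nat l 1)).
  by rewrite /Q; apply: computableb_all; [computable_auto|apply: computableb_answered => //;
    computable_auto].
have tcO : computable 2 (fun l => O (nth 0%nat l 0) (nth 0%nat l 1)).
  rewrite /O; apply: computable_sum; first by computable_auto.
  by apply: computable_mul; [apply: computable_estimate => //|]; computable_auto.
have [V [mV hV]] := search_machine tcQ tcO.
have [c hc] := oU V mV.
(* For [K = 2 ^ m] the input [decode K] has only [m] bits, so [q] has at most [m + c < K] bits; the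
   other summands put the whole block beyond [N] and [2 * d]. *)
pose m := (c + N + 2 * d + 3)%nat; pose K := (2 ^ m)%nat.
have hmK : (m + c + 1 <= K)%nat.
  have h : (m.-1 < 2 ^ m.-1)%nat by apply: ltn_expl.
  have : K = (2 * 2 ^ m.-1)%nat by rewrite -expnS prednK // /m addn3.
  rewrite /m in h *; lia.
have hK2 : (K < 2 ^ K)%nat by apply: ltn_expl.
have hsz : size (decode K) = m.
  rewrite size_decode; apply: trunc_log_eq => //; rewrite expnS -/K; apply/andP; split; first lia.
  by rewrite /m in hmK; lia.
have large i : (N <= 2 ^ K + i)%nat /\ (2 * d <= 2 ^ K + i)%nat by rewrite /m in hmK; lia.
have [i _|t0 ht0] := @eventually_all (2 ^ K) (fun i t => answered TA t (2 ^ K + i) d).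
  have [h1 h2] := large i; exact: (answered_eventually hA (hgood _ h1 h2)).
have hQ : Q t0 (code (decode K)).
  by rewrite decodeK; apply/allP => i; rewrite mem_iota => /andP[_ hi]; apply: ht0.
have [t [_ hQt hVt]] := hV _ _ hQ.
have [q [hUq hq]] := hc _ _ hVt.
rewrite decodeK in hQt hUq; rewrite hsz in hq.
have hqK : (code q < 2 ^ K)%nat.
  have h : (code q < (2 ^ K.-1.+1).-1)%nat by rewrite code_lt_exp; lia.
  by rewrite prednK in h; lia.
have approx i : (i < 2 ^ K)%nat ->
    (estimate TA t (2 ^ K + i) d * 2 ^ (2 ^ K + i - 2 * d)
       <= nhalt U (2 ^ K + i) + 2 ^ (2 ^ K + i - 2 * d))%nat /\
    (nhalt U (2 ^ K + i) < (estimate TA t (2 ^ K + i) d + 3) * 2 ^ (2 ^ K + i - 2 * d))%nat.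
  move=> hi; have [h1 h2] := large i.
  apply: (estimate_approx hA _ (ltW (hgood _ h1 h2))).
  by move/allP: hQt; apply; rewrite mem_iota.
have [h1 h2] := approx _ hqK; have [hn1 hn2] := large (code q).
have [t1 ht1] : exists t1, TU t1 (code q) = (O t K).+1 by apply/evU; rewrite codeK.
have hj : j (2 ^ K + code q)%nat = code q.
  rewrite /j (_ : trunc_log 2 _ = K) ?addKn //.
  by apply: trunc_log_eq => //; rewrite leq_addr expnS mul2n -addnn ltn_add2l.
apply: (hd (2 ^ K + code q)%nat t1 _ hn2 _ h1 h2).
rewrite /G hj ht1 /= /O digitE // => i hi.
by have [_ h] := large i; apply: (estimate_lt h (approx i hi).1).
Qed.

Unset Implicit Arguments.

Theorem theorem3p3 (U : seq bool -> option (seq bool)) :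
  machine U -> optimal U ->
  (forall A, rand_alg A -> (0 < E_inf U A)%E) /\
  (exists e : R, 0 < e /\ forall A, rand_alg A -> (e%:E <= E_sup U A)%E).
Proof.
by move=> mU oU; split; [move=> A; exact: E_inf_gt0|exact: E_sup_uniform].
Qed.
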